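(* Let $g:([n]\times\mathbb{Z})^*\to\mathbb{R}$ be a function, let $\alpha>0$, $\delta\in(0,1)$, and let $\mathcal{A}$ be an oblivious streaming algorithm for $g$ that uses space $L(\frac{\alpha}{10},\frac{1}{10})$ and guarantees, for streams of length $m$, that with probability at least $\frac{9}{10}$ all its estimates are accurate to within multiplicative error $(1\pm\frac{\alpha}{10})$. Then there exists an adversarially robust streaming algorithm for $g$ that, for streams of length $m$ chosen by an adaptive adversary, guarantees with probability at least $1-\delta$ that all its estimates are accurate to within multiplicative error $(1\pm\alpha)$, using space $$O\left( L\left(\tfrac{\alpha}{10},\tfrac{1}{10}\right)\cdot\sqrt{\lambda_{\frac{\alpha}{10},m}(g)\cdot\log\left(\tfrac{1}{\delta}\right)}\cdot\log\left(\tfrac{m}{\alpha\delta}\right)\right).$$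
   Context: A stream of length $m$ over $[n]$ is a sequence of updates $(a_1,\Delta_1),\dots,(a_m,\Delta_m)$ with $a_i\in[n]$, $\Delta_i\in\mathbb{Z}$; $\vec a_i=((a_1,\Delta_1),\dots,(a_i,\Delta_i))$ is its prefix of length $i$. After each update $i$ a streaming algorithm must output an estimate $z_i$ of $g(\vec a_i)$; an estimate $z$ is accurate to within multiplicative error $(1\pm\beta)$ if $z\in[(1-\beta)g(\vec a_i),(1+\beta)g(\vec a_i)]$. An oblivious streaming algorithm has its guarantee for any fixed stream chosen independently of its randomness. Adversarial robustness is defined via a game: in round $i$ an adaptive Adversary chooses the update $(a_i,\Delta_i)$ as a function of all previous updates and all previous outputs of the algorithm, and then the algorithm processes it and outputs $z_i$; the adversary wins if some $z_i$ is not accurate. The $(\alpha,m)$-flip number $\lambda_{\alpha,m}(g)$ is the maximum, over all streams of length $m$, of the largest $\ell$ for which there are indices $0\le i_1<\dots<i_\ell\le m$ with $g(\vec a_{i_{j+1}})\notin(1\pm\alpha)\,g(\vec a_{i_j})$ for all $j<\ell$ (i.e. the maximal number of times the value of $g$ can change by a factor $(1+\alpha)$ during a stream of length $m$). Standing assumptions: $\log m=\Theta(\log n)$, and $g$ (and the estimates of $\mathcal{A}$) take values bounded polynomially in $n$, namely in $[-n^c,-1/n^c]\cup\{0\}\cup[1/n^c,n^c]$ for some constant $c>0$.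
   Formalization: The constant in O(·) may depend on an upper bound δ0 < 1 for δ (besides the constants of the standing assumptions): with one constant for all δ in (0,1) the bound drops below one bit as δ → 1 and the claim fails. *)

(* Defs.v *)
From HB Require Import structures.
From mathcomp Require Import all_boot all_order all_algebra.
From mathcomp Require Import boolp reals exp.

Set Implicit Arguments.
Unset Strict Implicit.
Unset Printing Implicit Defensive.
Import Order.TTheory GRing.Theory Num.Theory.
Local Open Scope ring_scope.

Definition update (n : nat) : Type := ('I_n * int)%type.

(* z lies in the interval with endpoints (1 - b) x and (1 + b) x; this form is
   also the intended one when x < 0, where the endpoints are in reverse order *)
Definition approx (R : realType) (b x z : R) : bool := `|z - x| <= b * `|x|.

(* [-n^c, -1/n^c] u {0} u [1/n^c, n^c] *)
Definition poly_range (R : realType) (n : nat) (c x : R) : Prop :=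
  [\/ - (n%:R `^ c) <= x <= - (n%:R `^ c)^-1, x = 0
    | (n%:R `^ c)^-1 <= x <= n%:R `^ c].

(* A chain of l prefixes (given by their lengths) of some stream of length m
   along which g keeps leaving the (1 +- b) window around its last value.
   [sorted] compares consecutive indices only. *)
Definition flips (R : realType) (n : nat) (b : R) (m : nat)
    (g : seq (update n) -> R) (l : nat) : Prop :=
  exists (a : m.-tuple (update n)) (idx : seq nat),
    [/\ size idx = l, all (fun i => i <= m)%N idx &
        sorted [rel i j | (i < j)%N &&
                          ~~ approx b (g (take i a)) (g (take j a))] idx].

(* There are only m + 1 prefixes, so l <= m + 1 loses nothing *)
Definition flip_number (R : realType) (n : nat) (b : R) (m : nat)
    (g : seq (update n) -> R) : nat :=
  (\max_(l < m.+2 | `[< flips b m g l >]) l)%N.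

(* A randomized algorithm with finite memory.  Fresh coins are drawn
   independently before the stream starts and at every update; only what is
   written to the memory survives from one update to the next. *)
Record stream_alg (R : realType) (n : nat) := StreamAlg {
  memory : finType;
  coin : finType;
  coin_pr : coin -> R;
  coin_pr_ge0 : forall x, 0 <= coin_pr x;
  coin_pr_sum1 : \sum_x coin_pr x = 1;
  init : coin -> memory;
  step : memory -> update n -> coin -> memory * R
}.

(* in bits *)
Definition space_bits (R : realType) (n : nat) (A : stream_alg R n) : R :=
  ln #|memory A|%:R / ln 2.

(* The coins of a run on m updates: the first one is for the initial state *)
Definition coins_pr (R : realType) (n : nat) (A : stream_alg R n) (m : nat)
    (E : pred (m.+1.-tuple (coin A))) : R :=
  \sum_(w : m.+1.-tuple (coin A) | E w) \prod_(i < m.+1) coin_pr (tnth w i).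

(* A transcript lists the updates together with the estimates that follow *)
Definition transcript (R : realType) (n : nat) : Type := seq (update n * R).

Definition accurate (R : realType) (n : nat) (b : R)
    (g : seq (update n) -> R) (h : transcript R n) : bool :=
  all (fun i => approx b (g (take i.+1 (unzip1 h))) (nth 0 (unzip2 h) i))
      (iota 0 (size h)).

Fixpoint run (R : realType) (n : nat) (A : stream_alg R n) (s : memory A)
    (a : seq (update n)) (w : seq (coin A)) : transcript R n :=
  match a, w with
  | u :: a', x :: w' =>
      let sz := step s u x in (u, sz.2) :: run sz.1 a' w'
  | _, _ => [::]
  end.

Definition adversary (R : realType) (n : nat) : Type :=
  transcript R n -> update n.

Fixpoint play (R : realType) (n : nat) (A : stream_alg R n)
    (adv : adversary R n) (h : transcript R n) (s : memory A)
    (w : seq (coin A)) : transcript R n :=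
  if w is x :: w' then
    let u := adv h in
    let sz := step s u x in
    play adv (rcons h (u, sz.2)) sz.1 w'
  else h.

Definition oblivious_correct (R : realType) (n : nat) (b p : R) (m : nat)
    (g : seq (update n) -> R) (A : stream_alg R n) : Prop :=
  forall a : m.-tuple (update n),
    p <= coins_pr (fun w : m.+1.-tuple (coin A) =>
           accurate b g (run (init (thead w)) a (behead w))).

Definition robust_correct (R : realType) (n : nat) (b p : R) (m : nat)
    (g : seq (update n) -> R) (A : stream_alg R n) : Prop :=
  forall adv : adversary R n,
    p <= coins_pr (fun w : m.+1.-tuple (coin A) =>
           accurate b g (play adv [::] (init (thead w)) (behead w))).

(* Main.v *)
Require Import Defs.
From HB Require Import structures.
From mathcomp Require Import all_boot all_order all_algebra.
From mathcomp Require Import boolp reals sequences exp.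
From mathcomp Require Import ring lra zify.

Set Implicit Arguments.
Unset Strict Implicit.
Unset Printing Implicit Defensive.
Import Order.TTheory GRing.Theory Num.Theory.
Local Open Scope ring_scope.

(* The robust algorithm runs k = 20q independent copies of A and keeps a current
   output z from a finite grid of values.  In every round it draws the next
   output v with probability proportional to (1 + eps)^(score v), where score v
   counts the copies whose estimates are close to v, with a bonus for v = z.  As
   long as few copies are wrong, z is left only when g has really moved, so z
   changes less often than the flip number.

   One copy influences a score by at most 1, hence the law of a round by a
   factor 1 + O(eps), and a round that moves with probability p costs only
   O(eps^2 p) in the moments of the likelihood ratio.  Along a run with at most
   L changes these moments are therefore bounded by a function of eps^2 L, so
   that with eps ~ 1/sqrt(L log(1/delta)) the whole run is differentially
   private.  A private mechanism cannot choose a stream on which many of the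
   independent copies fail.  The moment bound needs L >= log(1/delta); for
   smaller L a union bound over all runs with at most L changes is enough. *)

(** * Processes on a finite set of outputs *)

Lemma sum_tuple_nil (R : nmodType) (T : finType) (F : seq T -> R) :
  \sum_(t : 0.-tuple T) F t = F [::].
Proof.
rewrite (big_pred1 [tuple]) //= => t.
by apply/esym/eqP/val_inj; rewrite /= (tuple0 t).
Qed.

Lemma sum_tuple_cons (R : nmodType) (T : finType) (n : nat) (F : seq T -> R) :
  \sum_(t : n.+1.-tuple T) F t = \sum_x \sum_(t : n.-tuple T) F (x :: t).
Proof.
rewrite pair_big /=.
rewrite (reindex (fun p : T * n.-tuple T => cons_tuple p.1 p.2)) //=.
exists (fun t => (thead t, behead_tuple t)) => [[x t] _|t _] /=.
  by congr (_, _); apply/val_inj.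
by case/tupleP: t => x t; apply/val_inj.
Qed.

Definition iid (R : realType) (T : finType) (mu : T -> R) (w : seq T) : R :=
  \prod_(x <- w) mu x.

Lemma iid_ge0 (R : realType) (T : finType) (mu : T -> R) (w : seq T) :
  (forall x, 0 <= mu x) -> 0 <= iid mu w.
Proof. by move=> mu0; apply: prodr_ge0. Qed.

Lemma iid_cons (R : realType) (T : finType) (mu : T -> R) x (w : seq T) :
  iid mu (x :: w) = mu x * iid mu w.
Proof. exact: big_cons. Qed.

Lemma iid_sum1 (R : realType) (T : finType) (mu : T -> R) (n : nat) :
  \sum_x mu x = 1 -> \sum_(w : n.-tuple T) iid mu w = 1.
Proof.
move=> mu1; elim: n => [|n IH]; first by rewrite (sum_tuple_nil (iid mu)) /iid big_nil.
rewrite (sum_tuple_cons n (iid mu)); under eq_bigr => x _.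
  by under eq_bigr => t _ do rewrite iid_cons; rewrite -mulr_sumr IH mulr1; over.
exact: mu1.
Qed.

Fixpoint path_pr (R : realType) (V : finType) (kern : seq V -> V -> R)
    (h t : seq V) : R :=
  if t is v :: t' then kern h v * path_pr kern (rcons h v) t' else 1.

Fixpoint changes (V : eqType) (z : V) (t : seq V) : nat :=
  if t is v :: t' then ((v != z) + changes v t')%N else 0%N.

Fixpoint all_steps (V : Type) (ok : seq V -> V -> bool) (h t : seq V) : bool :=
  if t is v :: t' then ok h v && all_steps ok (rcons h v) t' else true.

Lemma changes_rcons (V : eqType) (z : V) (t : seq V) (v : V) :
  changes z (rcons t v) = (changes z t + (v != last z t))%N.
Proof. by elim: t z => [|x t IH] z /=; rewrite ?addn0 ?add0n// IH addnA. Qed.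

Section Paths.
Variables (R : realType) (V : finType).
Implicit Types (K : seq V -> V -> R) (h t : seq V).

Lemma path_pr_ge0 K h t : (forall h v, 0 <= K h v) -> 0 <= path_pr K h t.
Proof. by move=> K0; elim: t h => //= v t IH h; rewrite mulr_ge0. Qed.

Lemma path_pr_sum1 K n h :
  (forall h, \sum_v K h v = 1) -> \sum_(t : n.-tuple V) path_pr K h t = 1.
Proof.
move=> K1; elim: n h => [|n IH] h; first by rewrite (sum_tuple_nil (path_pr K h)).
rewrite (sum_tuple_cons n (path_pr K h)) /= -[RHS](K1 h); apply: eq_bigr => v _.
by rewrite -mulr_sumr IH mulr1.
Qed.

Lemma path_pr_le1 K n h (t : n.-tuple V) :
  (forall h v, 0 <= K h v) -> (forall h, \sum_v K h v = 1) ->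
  path_pr K h t <= 1.
Proof.
move=> K0 K1; rewrite -(path_pr_sum1 n h K1) (bigD1 t)//= lerDl.
by apply: sumr_ge0 => s _; apply: path_pr_ge0.
Qed.

Lemma step_failure K (ok : seq V -> V -> bool) (e : R) n h :
  (forall h v, 0 <= K h v) -> (forall h, \sum_v K h v = 1) ->
  (forall h, \sum_(v | ~~ ok h v) K h v <= e) ->
  \sum_(t : n.-tuple V) path_pr K h t * (~~ all_steps ok h t)%:R <= n%:R * e.
Proof.
move=> K0 K1 Ke; elim: n h => [|n IH] h.
  by rewrite (sum_tuple_nil (fun t => path_pr K h t * (~~ all_steps ok h t)%:R))
    /= mulr0 mul0r.
rewrite (sum_tuple_cons n (fun t => path_pr K h t * (~~ all_steps ok h t)%:R)) /=.
apply: (@le_trans _ _ (\sum_v (K h v * (~~ ok h v)%:R + K h v * (n%:R * e)))).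
  apply: ler_sum => v _; rewrite -mulrDr.
  under eq_bigr => t _ do rewrite -mulrA.
  rewrite -mulr_sumr ler_wpM2l//.
  apply: (@le_trans _ _ (\sum_(t : n.-tuple V) (path_pr K (rcons h v) t *
      (~~ ok h v)%:R + path_pr K (rcons h v) t *
      (~~ all_steps ok (rcons h v) t)%:R))).
    apply: ler_sum => t _; rewrite -mulrDr ler_wpM2l ?path_pr_ge0//.
    by rewrite -natrD ler_nat; case: (ok h v); case: (all_steps _ _ _).
  by rewrite big_split /= -mulr_suml path_pr_sum1// mul1r lerD2l.
rewrite big_split /= -mulr_suml K1 mul1r -(natr1 n) mulrDl mul1r addrC lerD2l.
rewrite (le_trans _ (Ke h))// [leRHS]big_mkcond/=; apply: ler_sum => v _.
by case: (ok h v); rewrite ?mulr0 ?mulr1.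
Qed.

Lemma frozen_changes K z L h t :
  (forall h v, K h v != 0 -> (L <= changes z h)%N -> v = last z h) ->
  path_pr K h t != 0 -> (changes z h <= L)%N -> (changes z (h ++ t) <= L)%N.
Proof.
move=> fr; elim: t h => [|v t IH] h /=; first by rewrite cats0.
rewrite mulf_eq0 negb_or => /andP[Kv Kt] hL.
rewrite -cat_rcons; apply: IH => //; rewrite changes_rcons.
have [Lh|] := leqP L (changes z h).
  by rewrite (fr _ _ Kv Lh) eqxx addn0.
by case: (v != _); rewrite ?addn1 ?addn0// => /ltnW.
Qed.

Lemma weighted_paths (x : R) n z : 0 <= x ->
  \sum_(t : n.-tuple V) x ^+ changes z t <= (1 + #|V|%:R * x) ^+ n.
Proof.
move=> x0; elim: n z => [|n IH] z; first by
  rewrite (sum_tuple_nil (fun t => x ^+ changes z t)).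
rewrite (sum_tuple_cons n (fun t => x ^+ changes z t)) /= exprS mulrDl mul1r.
rewrite (bigD1 z)//= eqxx lerD ?IH//.
rewrite -mulrA mulr_natl -sumr_const big_mkcond/=.
apply: ler_sum => v _; case: (v != z) => /=; last first.
  by rewrite mulr_ge0// exprn_ge0// addr_ge0// mulr_ge0.
under eq_bigr => t _ do rewrite exprS.
by rewrite -mulr_sumr ler_wpM2l.
Qed.

Lemma few_changes_count (x : R) L n z : 0 < x <= 1 ->
  \sum_(t : n.-tuple V | (changes z t <= L)%N) 1 <=
    x ^- L * (1 + #|V|%:R * x) ^+ n.
Proof.
move=> /andP[x0 x1]; rewrite ler_pdivlMl ?exprn_gt0//.
apply: le_trans (weighted_paths n z (ltW x0)).
rewrite mulr_sumr big_mkcond/=; apply: ler_sum => t _; rewrite mulr1.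
case: ifP => [tL|_]; last by rewrite exprn_ge0// ltW.
by apply: ler_wiXn2l => //; rewrite ltW.
Qed.

End Paths.

Section Privacy.
Variables (R : realType) (V : finType).

(* Writing d = 1 - Q/P, Bernoulli's inequality gives
   (P/Q)^th <= 1/(1 - th d) <= 1 + th d + 2 (th d)^2; the linear terms sum to
   0, and the mass d puts on z is minus the mass it puts off z. *)
Lemma moment_step (P Q : V -> R) (z : V) (D : R) (th : nat) :
  (forall v, 0 <= P v) -> \sum_v P v = 1 -> \sum_v Q v = 1 ->
  (forall v, `|P v - Q v| <= D * P v) -> (0 < th)%N -> 0 <= D ->
  th%:R * D <= 1/4 ->
  \sum_v P v * (P v / Q v) ^+ th * (1 - 8 * th%:R ^+ 2 * D ^+ 2) ^+ (v != z)
    <= 1.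
Proof.
move=> P0 P1 Q1 PQ th0 D0 thD.
set T : R := th%:R in thD *; set et := 8 * T ^+ 2 * D ^+ 2.
have T1 : 1 <= T by rewrite ler1n.
have D14 : D <= 1/4 by apply: le_trans thD; rewrite ler_peMl.
have TD0 : 0 <= T * D by rewrite mulr_ge0// (le_trans ler01).
have et0 : 0 <= et by rewrite /et -mulrA -exprMn mulr_ge0// exprn_ge0.
have et1 : et <= 1/2.
  rewrite /et -mulrA -exprMn.
  have : (T * D) ^+ 2 <= (1/4) ^+ 2 by rewrite lerXn2r// nnegrE//; lra.
  lra.
pose d v := (P v - Q v) / P v.
have Pd v : P v * d v = P v - Q v.
  have [Pv|Pv] := eqVneq (P v) 0; last by rewrite /d mulrC divfK.
  by have := PQ v; rewrite Pv mulr0 mul0r normr_le0 => /eqP->.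
have dD v : `|d v| <= D.
  have [Pv|Pv] := eqVneq (P v) 0; first by rewrite /d Pv invr0 mulr0 normr0.
  rewrite /d normrM normfV ler_pdivrMr ?normr_gt0//.
  by rewrite [X in _ * X]ger0_norm.
have ratio v : P v * (P v / Q v) ^+ th = P v * (1 - d v) ^- th.
  have [Pv|Pv] := eqVneq (P v) 0; first by rewrite Pv !mul0r.
  congr (_ * _); rewrite -exprVn; congr (_ ^+ _).
  rewrite /d; apply/esym; rewrite -[1](@divff _ (P v))// -mulrBl invf_div.
  by congr (_ / _); lra.
have dpos v : 0 < 1 - d v by have := dD v; rewrite ler_norml; lra.
have Td v : -(1/4) <= T * d v <= 1/4.
  rewrite -ler_norml normrM ger0_norm ?(le_trans ler01)// (le_trans _ thD)//.
  by rewrite ler_wpM2l// (le_trans ler01).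
have bern (x : R) : -1 <= x -> 1 + T * x <= (1 + x) ^+ th.
  rewrite /T; elim: (th) => [|n IH] x1; first by rewrite mul0r addr0 expr0.
  rewrite exprS; apply: le_trans (_ : (1 + x) * (1 + n%:R * x) <= _).
    rewrite -(natr1 n); have : 0 <= n%:R * x ^+ 2 by rewrite mulr_ge0// sqr_ge0.
    by lra.
  by rewrite ler_wpM2l ?IH//; lra.
have up v : (1 - d v) ^- th <= 1 + T * d v + 2 * T ^+ 2 * d v ^+ 2.
  have b := bern (- d v); have dv := dD v; have /andP[Td1 Td2] := Td v.
  have b' : 1 - T * d v <= (1 - d v) ^+ th.
    by rewrite -mulrN; apply: b; move: dv; rewrite ler_norml; lra.
  have p1 : 0 < 1 - T * d v by lra.
  have : (1 - d v) ^- th <= (1 - T * d v)^-1.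
    by rewrite lef_pV2// posrE ?exprn_gt0.
  move=> /le_trans; apply; rewrite -div1r ler_pdivrMr//.
  move: Td1 Td2; rewrite -mulrA -exprMn; move: (T * d v) => y y1 y2.
  have : 0 <= y ^+ 2 * (1 - 2 * y) by rewrite mulr_ge0 ?sqr_ge0//; lra.
  by lra.
have low v : 1/2 <= (1 - d v) ^- th.
  have := dD v; rewrite ler_norml => /andP[d1 d2]; have /andP[Td1 Td2] := Td v.
  apply: le_trans (_ : 1 + T * d v <= _); first by lra.
  apply: le_trans (bern _ _) _; first lra.
  have d0 : 0 <= 1 + d v by lra.
  rewrite -exprVn lerXn2r ?nnegrE ?invr_ge0 ?(ltW (dpos v))//.
  rewrite -[leRHS]div1r ler_pdivlMr//.
  by have := sqr_ge0 (d v); lra.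
pose p := \sum_(v | v != z) P v.
have pz : P z = 1 - p by rewrite -P1 (bigD1 z)//= addrK.
have p0 : 0 <= p by apply: sumr_ge0.
have Pdz : `|P z * d z| <= p * D.
  have : P z * d z = - \sum_(v | v != z) P v * d v.
    apply/eqP; rewrite -addr_eq0; apply/eqP.
    transitivity (\sum_v P v * d v); first by rewrite [RHS](bigD1 z).
    by under eq_bigr do rewrite Pd; rewrite big_split/= sumrN P1 Q1 subrr.
  move=> ->; rewrite normrN (le_trans (ler_norm_sum _ _ _))// mulr_suml.
  by apply: ler_sum => v _; rewrite normrM ger0_norm// ler_wpM2l.
have Pd2 : \sum_v P v * d v ^+ 2 <= 2 * p * D ^+ 2.
  rewrite (bigD1 z)//=.
  have z2 : P z * d z ^+ 2 <= p * D ^+ 2.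
    rewrite expr2 mulrA (le_trans (ler_norm _))// normrM expr2 mulrA.
    by rewrite ler_pM.
  have nz2 : \sum_(v | v != z) P v * d v ^+ 2 <= p * D ^+ 2.
    rewrite mulr_suml; apply: ler_sum => v _; rewrite ler_wpM2l//.
    by rewrite -real_normK ?num_real// lerXn2r ?nnegrE.
  by lra.
have term v : P v * (P v / Q v) ^+ th * (1 - et) ^+ (v != z) <=
   P v + T * (P v - Q v) + 2 * T ^+ 2 * (P v * d v ^+ 2)
   - (et / 2) * (P v * (v != z)%:R).
  rewrite ratio.
  have -> : P v + T * (P v - Q v) + 2 * T ^+ 2 * (P v * d v ^+ 2) =
     P v * (1 + T * d v + 2 * T ^+ 2 * d v ^+ 2).
    by rewrite -Pd; ring.
  have := ler_wpM2l (P0 v) (up v); have := ler_wpM2l (P0 v) (low v).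
  case: (v != z); rewrite ?expr0 ?expr1 ?mulr1 ?mulr0 ?subr0// => l u.
  have := ler_wpM2l et0 l.
  by move: l u; set Y := P v * _ ^- th; set W := P v * (_ + _); lra.
apply: le_trans (ler_sum _ (fun v _ => term v)) _.
rewrite !big_split/= sumrN -!mulr_sumr !big_split/= sumrN P1 Q1 subrr mulr0 addr0.
have -> : \sum_v P v * (v != z)%:R = p.
  rewrite /p [RHS]big_mkcond/=; apply: eq_bigr => v _.
  by case: (v != z); rewrite ?mulr1 ?mulr0.
have T2 : 0 <= 2 * T ^+ 2 by rewrite mulr_ge0// sqr_ge0.
have := ler_wpM2l T2 Pd2; rewrite /et; lra.
Qed.
End Privacy.

Section Composition.
Variables (R : realType) (V : finType).
Implicit Types (K : seq V -> V -> R) (h t : seq V).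

Lemma moment_paths K K' z (w : R) (th n : nat) h :
  (forall h v, 0 <= K h v) -> 0 <= w ->
  (forall h, \sum_v K h v * (K h v / K' h v) ^+ th * w ^+ (v != last z h) <= 1) ->
  (forall h v, 0 <= K' h v) ->
  \sum_(t : n.-tuple V) path_pr K h t * (path_pr K h t / path_pr K' h t) ^+ th *
     w ^+ changes (last z h) t <= 1.
Proof.
move=> K0 w0 KK' K'0; elim: n h => [|n IH] h.
  by rewrite (sum_tuple_nil (fun t => path_pr K h t *
    (path_pr K h t / path_pr K' h t) ^+ th * w ^+ changes (last z h) t)) /=
    divr1 expr1n !mulr1.
rewrite (sum_tuple_cons n (fun t => path_pr K h t *
    (path_pr K h t / path_pr K' h t) ^+ th * w ^+ changes (last z h) t)) /=.
apply: le_trans (KK' h); apply: ler_sum => v _.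
apply: (@le_trans _ _ (K h v * (K h v / K' h v) ^+ th * w ^+ (v != last z h) *
  \sum_(t : n.-tuple V) path_pr K (rcons h v) t *
     (path_pr K (rcons h v) t / path_pr K' (rcons h v) t) ^+ th *
     w ^+ changes (last z (rcons h v)) t)).
  rewrite mulr_sumr; apply: ler_sum => t _; rewrite last_rcons exprD.
  rewrite le_eqVlt; apply/orP; left; apply/eqP.
  by rewrite -mulf_div exprMn; ring.
by rewrite ler_piMr// !mulr_ge0 ?exprn_ge0 ?divr_ge0.
Qed.

Lemma path_pr_neq0 K K' h t :
  (forall h v, K h v != 0 -> K' h v != 0) ->
  path_pr K h t != 0 -> path_pr K' h t != 0.
Proof.
move=> KK'; elim: t h => //= v t IH h; rewrite !mulf_eq0 !negb_or.
by move=> /andP[/KK'-> /IH].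
Qed.

Lemma privacy_loss K K' z (a w : R) (th n L : nat) :
  (forall h v, 0 <= K h v) -> (forall h v, 0 <= K' h v) ->
  (forall h v, K h v != 0 -> K' h v != 0) ->
  0 < w <= 1 -> 0 < a ->
  (forall h, \sum_v K h v * (K h v / K' h v) ^+ th * w ^+ (v != last z h) <= 1) ->
  (forall t : n.-tuple V, path_pr K [::] t != 0 -> (changes z t <= L)%N) ->
  \sum_(t : n.-tuple V) Num.max 0 (path_pr K [::] t - a * path_pr K' [::] t) <=
    a ^- th * w ^- L.
Proof.
move=> K0 K'0 KK' /andP[w0 w1] a0 KM tL.
have c0 : 0 <= a ^- th * w ^- L by rewrite mulr_ge0// invr_ge0 exprn_ge0// ltW.
have := ler_wpM2l c0 (moment_paths n [::] K0 (ltW w0) KM K'0).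
rewrite mulr1; apply: le_trans.
rewrite mulr_sumr; apply: ler_sum => t _ /=.
set P := path_pr K [::] t; set P' := path_pr K' [::] t.
have P0 : 0 <= P by apply: path_pr_ge0.
have P'0 : 0 <= P' by apply: path_pr_ge0.
have [PE|Pn0] := eqVneq P 0.
  rewrite PE !mul0r mulr0 sub0r ge_max lexx oppr_le0.
  by rewrite mulr_ge0// ltW.
have Pp : 0 < P by rewrite lt_def Pn0.
have P'p : 0 < P' by rewrite lt_def P'0 andbT; exact: path_pr_neq0 Pn0.
have rhs0 : 0 <= P * (P / P') ^+ th * w ^+ changes z t.
  by rewrite !mulr_ge0 ?exprn_ge0 ?divr_ge0// ltW.
rewrite ge_max mulr_ge0//=.
have [Pa|aP] := leP P (a * P').
  by rewrite (@le_trans _ _ 0) ?subr_le0// mulr_ge0.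
apply: (@le_trans _ _ P); first by rewrite gerBl mulr_ge0// ltW.
have -> : a ^- th * w ^- L * (P * (P / P') ^+ th * w ^+ changes z t) =
    P * ((P / P' / a) ^+ th * (w ^+ changes z t / w ^+ L)).
  by rewrite [in RHS]expr_div_n; ring.
rewrite ler_peMr// mulr_ege1//.
  by rewrite exprn_ege1// ler_pdivlMr// ler_pdivlMr// mul1r ltW.
by rewrite ler_pdivlMr ?exprn_gt0// mul1r ler_wiXn2l ?(ltW w0)// tL.
Qed.
End Composition.

(** * Generalization of stable mechanisms *)

Definition update_at (k : nat) (X : finType) (r : {ffun 'I_k -> X}) (j : 'I_k)
    (x : X) : {ffun 'I_k -> X} := [ffun i => if i == j then x else r i].

Definition product_pr (R : realType) (k : nat) (X : finType) (mu : X -> R)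
    (r : {ffun 'I_k -> X}) : R := \prod_j mu (r j).

Lemma product_pr_ge0 (R : realType) k (X : finType) (mu : X -> R)
    (r : {ffun 'I_k -> X}) : (forall x, 0 <= mu x) -> 0 <= product_pr mu r.
Proof. by move=> mu0; apply: prodr_ge0. Qed.

Lemma product_pr_sum (R : realType) k (X : finType) (mu : X -> R) (f : X -> R) :
  \sum_(r : {ffun 'I_k -> X}) product_pr mu r * (\prod_j f (r j)) =
  (\sum_x mu x * f x) ^+ k.
Proof.
rewrite -[k in RHS]card_ord -prodr_const bigA_distr_bigA /=.
by apply: eq_bigr => r _; rewrite big_split.
Qed.

Lemma product_pr_sum1 (R : realType) k (X : finType) (mu : X -> R) :
  \sum_x mu x = 1 -> \sum_(r : {ffun 'I_k -> X}) product_pr mu r = 1.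
Proof.
move=> mu1; transitivity ((\sum_x mu x * 1) ^+ k); last first.
  by under eq_bigr do rewrite mulr1; rewrite mu1 expr1n.
rewrite -product_pr_sum; apply: eq_bigr => r _.
by rewrite big1 ?mulr1.
Qed.

Lemma resample (R : realType) k (X : finType) (mu : X -> R) (j : 'I_k)
    (F : {ffun 'I_k -> X} -> X -> R) :
  \sum_r product_pr mu r * (\sum_x mu x * F r x) =
  \sum_r product_pr mu r * (\sum_x mu x * F (update_at r j x) (r j)).
Proof.
under eq_bigr do rewrite mulr_sumr; under [RHS]eq_bigr do rewrite mulr_sumr.
rewrite !pair_big /=.
rewrite (reindex (fun p : {ffun 'I_k -> X} * X => (update_at p.1 j p.2, p.1 j))).
  apply: eq_bigr => -[r x] _ /=; rewrite !mulrA; congr (_ * _).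
  rewrite /product_pr (bigD1 j)//= [in RHS](bigD1 j)//= ffunE eqxx.
  have -> : \prod_(i < k | i != j) mu (update_at r j x i) =
      \prod_(i < k | i != j) mu (r i).
    by apply: eq_bigr => i /negPf ij; rewrite ffunE ij.
  by ring.
pose swap (p : {ffun 'I_k -> X} * X) := (update_at p.1 j p.2, p.1 j).
have inv : involutive swap.
  move=> [r x]; rewrite /swap /= ffunE eqxx; congr (_, _).
  by apply/ffunP => i; rewrite !ffunE; case: eqP => // ->.
by exists swap => p _; exact: inv.
Qed.

Section Generalization.
Variables (R : realType) (k : nat) (X T : finType) (mu : X -> R).
Variables (P : {ffun 'I_k -> X} -> T -> R) (bad : T -> pred X).
Hypothesis mu_ge0 : forall x, 0 <= mu x.
Hypothesis mu_sum1 : \sum_x mu x = 1.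
Hypothesis P_ge0 : forall r t, 0 <= P r t.
Hypothesis P_sum1 : forall r, \sum_t P r t = 1.

Definition num_bad (t : T) (r : {ffun 'I_k -> X}) : nat :=
  (\sum_j (bad t (r j) : nat))%N.

Definition joint_ex (f : {ffun 'I_k -> X} -> T -> R) : R :=
  \sum_r product_pr mu r * (\sum_t P r t * f r t).

Lemma joint_ex_le f f' : (forall r t, f r t <= f' r t) ->
  joint_ex f <= joint_ex f'.
Proof.
move=> ff; apply: ler_sum => r _; rewrite ler_wpM2l ?product_pr_ge0//.
by apply: ler_sum => t _; rewrite ler_wpM2l.
Qed.

Lemma joint_exZ c f : joint_ex (fun r t => c * f r t) = c * joint_ex f.
Proof.
rewrite /joint_ex mulr_sumr; apply: eq_bigr => r _.
rewrite mulrCA; congr (_ * _); rewrite mulr_sumr.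
by apply: eq_bigr => t _; rewrite mulrCA.
Qed.

Lemma joint_exD f f' : 
  joint_ex (fun r t => f r t + f' r t) = joint_ex f + joint_ex f'.
Proof.
rewrite /joint_ex -big_split/=; apply: eq_bigr => r _.
rewrite -mulrDr -big_split/=; congr (_ * _).
by apply: eq_bigr => t _; rewrite mulrDr.
Qed.

Lemma joint_ex_sum (I : finType) (f : I -> {ffun 'I_k -> X} -> T -> R) :
  joint_ex (fun r t => \sum_i f i r t) = \sum_i joint_ex (f i).
Proof.
rewrite /joint_ex [RHS]exchange_big/=; apply: eq_bigr => r _.
rewrite -mulr_sumr [in RHS]exchange_big/=; congr (_ * _).
by apply: eq_bigr => t _; rewrite mulr_sumr.
Qed.

Lemma joint_ex_cst c : joint_ex (fun _ _ => c) = c.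
Proof.
rewrite /joint_ex -[RHS]mul1r -(product_pr_sum1 k mu_sum1) mulr_suml.
by apply: eq_bigr => r _; rewrite -mulr_suml P_sum1 mul1r.
Qed.

Variables (a s K delta p : R) (phi : nat -> R).
Hypothesis a_ge0 : 0 <= a.
Hypothesis bad_le : forall t, \sum_x mu x * (bad t x)%:R <= p.
Hypothesis private : forall r j x,
  \sum_t Num.max 0 (P r t - a * P (update_at r j x) t) <= delta.
Hypothesis phi_ge0 : forall N, 0 <= phi N.
Hypothesis phi_le : forall N, phi N <= K.
Hypothesis phi_mono : forall N, phi N <= phi N.+1.
Hypothesis phi_lip : forall N, phi N.+1 <= s * phi N.
Hypothesis s_ge1 : 1 <= s.

Lemma phi_update t r j x :
  phi (num_bad t r) <= s * phi (num_bad t (update_at r j x)).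
Proof.
rewrite /num_bad (bigD1 j)//= [in leRHS](bigD1 j)//= ffunE eqxx.
have -> : (\sum_(i < k | i != j) (bad t (update_at r j x i) : nat))%N =
    (\sum_(i < k | i != j) (bad t (r i) : nat))%N.
  by apply: eq_bigr => i /negPf ij; rewrite ffunE ij.
set N := (\sum_(i < k | _) _)%N.
have w (y : R) : 0 <= y -> y <= s * y by move=> y0; rewrite ler_peMl.
case: (bad t (r j)); case: (bad t x); rewrite ?add0n ?add1n ?w//.
by rewrite (le_trans (phi_mono N))// w.
Qed.

(* Stability: r j may be replaced in the mechanism and in phi by an independent
   copy, after which its badness is independent of t. *)
Lemma weighted_num_bad :
  joint_ex (fun r t => (num_bad t r)%:R * phi (num_bad t r)) <=
  k%:R * (p * a * s * joint_ex (fun r t => phi (num_bad t r)) + K * delta).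
Proof.
have -> : joint_ex (fun r t => (num_bad t r)%:R * phi (num_bad t r)) =
    \sum_j joint_ex (fun r t => (bad t (r j))%:R * phi (num_bad t r)).
  rewrite -joint_ex_sum; congr joint_ex; apply/funext => r; apply/funext => t.
  by rewrite -mulr_suml natr_sum.
rewrite -[k in k%:R]card_ord mulr_natl -sumr_const; apply: ler_sum => j _.
have K0 : 0 <= K by apply: le_trans (phi_le 0).
have s_ge0 : 0 <= s by apply: le_trans s_ge1.
pose F r x := \sum_t a * s * P r t * (bad t x)%:R * phi (num_bad t r).
have step r x : \sum_t P r t * ((bad t (r j))%:R * phi (num_bad t r)) <=
    F (update_at r j x) (r j) + K * delta.
  apply: (@le_trans _ _ (F (update_at r j x) (r j) + K *
     (\sum_t Num.max 0 (P r t - a * P (update_at r j x) t)))); last first.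
    by rewrite lerD2l ler_wpM2l.
  rewrite mulr_sumr -big_split/=; apply: ler_sum => t _.
  set m := Num.max _ _.
  have m0 : 0 <= m by rewrite le_max lexx.
  have Pm : P r t <= a * P (update_at r j x) t + m.
    by rewrite -lerBlDl le_max lexx orbT.
  apply: (@le_trans _ _ ((a * P (update_at r j x) t + m) *
     ((bad t (r j))%:R * phi (num_bad t r)))).
    by rewrite ler_wpM2r// mulr_ge0.
  rewrite mulrDl lerD//.
    have -> : a * s * P (update_at r j x) t * (bad t (r j))%:R *
        phi (num_bad t (update_at r j x)) = a * P (update_at r j x) t *
        ((bad t (r j))%:R * (s * phi (num_bad t (update_at r j x)))) by ring.
    by rewrite ler_wpM2l ?mulr_ge0// ler_wpM2l// phi_update.
  rewrite [leRHS]mulrC ler_wpM2l//.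
  by case: (bad _ _); rewrite ?mul1r ?mul0r// phi_le.
have {step} : joint_ex (fun r t => (bad t (r j))%:R * phi (num_bad t r)) <=
   \sum_r product_pr mu r * (\sum_x mu x * F (update_at r j x) (r j)) + K * delta.
  have mc c : c = \sum_x mu x * c by rewrite -mulr_suml mu_sum1 mul1r.
  have rc c : c = \sum_(r : {ffun 'I_k -> X}) product_pr mu r * c.
    by rewrite -mulr_suml product_pr_sum1// mul1r.
  rewrite [K * delta]rc -big_split/=.
  apply: ler_sum => r _; rewrite -mulrDr ler_wpM2l ?product_pr_ge0//.
  rewrite [leLHS]mc [K * delta]mc -big_split/=.
  by apply: ler_sum => x _; rewrite -mulrDr ler_wpM2l.
rewrite -(resample mu j F) => /le_trans; apply; rewrite lerD2r.
rewrite -joint_exZ; apply: ler_sum => r _.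
rewrite ler_wpM2l ?product_pr_ge0// /F.
under eq_bigr do rewrite mulr_sumr.
rewrite exchange_big/=; apply: ler_sum => t _.
have -> : \sum_x mu x * (a * s * P r t * (bad t x)%:R * phi (num_bad t r)) =
   (\sum_x mu x * (bad t x)%:R) * (a * s * P r t * phi (num_bad t r)).
  by rewrite mulr_suml; apply: eq_bigr => x _; ring.
apply: le_trans (_ : p * (a * s * P r t * phi (num_bad t r)) <= _).
  by rewrite ler_wpM2r// !mulr_ge0.
by rewrite le_eqVlt; apply/orP; left; apply/eqP; ring.
Qed.

End Generalization.

Lemma private_generalization (R : realType) (q : nat) (X T : finType)
    (mu : X -> R) (P : {ffun 'I_(20 * q) -> X} -> T -> R) (bad : T -> pred X)
    (delta : R) :
  (forall x, 0 <= mu x) -> \sum_x mu x = 1 ->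
  (forall r t, 0 <= P r t) -> (forall r, \sum_t P r t = 1) ->
  (forall t, \sum_x mu x * (bad t x)%:R <= 1/10) -> 
  (forall r j x,
     \sum_t Num.max 0 (P r t - 6/5 * P (update_at r j x) t) <= delta) ->
  (0 < q)%N ->
  joint_ex mu P (fun r t => (4 * q <= num_bad bad t r)%N%:R) <=
    20 * delta + 3 * (6/5) ^- q.
Proof.
move=> mu0 mu1 P0 P1 bad1 priv q0.
pose b : R := 6/5; pose phi N := b ^+ minn N (4 * q).
have b1 : 1 <= b by rewrite /b; lra.
have b0 : 0 < b by rewrite /b; lra.
have phi0 N : 0 <= phi N by rewrite exprn_ge0// ltW.
have phiK N : phi N <= b ^+ (4 * q) by rewrite /phi ler_weXn2l// geq_minr.
have phim N : phi N <= phi N.+1.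
  by rewrite /phi ler_weXn2l// leq_min geq_minr andbT (leq_trans (geq_minl _ _)).
have phil N : phi N.+1 <= b * phi N.
  rewrite /phi -exprS ler_weXn2l//; lia.
have bb : 0 <= b by exact: ltW.
have := weighted_num_bad mu0 mu1 P0 bb bad1 priv phi0 phiK phim phil b1.
set E := joint_ex mu P.
set A := E _; set B := E _; set K := b ^+ (4 * q) => AB.
set W := E _.
have q0' : 0 < q%:R :> R by rewrite ltr0n.
have : q%:R * K * W - 3 * q%:R * b ^+ (3 * q) <= A + (- (3 * q%:R)) * B.
  rewrite /W /A /B /E -!joint_exZ -joint_exD.
  rewrite -(joint_ex_cst mu1 P1 (- (3 * q%:R * b ^+ (3 * q)))) -joint_exD.
  apply: joint_ex_le => // r t; set N := num_bad _ _ _.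
  rewrite mulNr -mulrBl.
  have c0 : 0 <= 3 * q%:R * b ^+ (3 * q) by rewrite !mulr_ge0// exprn_ge0.
  have [N4|N4] := leqP (4 * q) N.
    rewrite mulr1 /phi (minn_idPr N4) -/K.
    apply: (@le_trans _ _ (q%:R * K)); first lra.
    rewrite ler_wpM2r ?exprn_ge0// lerBrDr.
    by rewrite -natrM -natrD ler_nat; lia.
  rewrite mulr0 add0r /phi (minn_idPl (ltnW N4)).
  have [N3|N3] := leqP (3 * q) N.
    rewrite (@le_trans _ _ 0) ?oppr_le0// mulr_ge0 ?exprn_ge0//.
    by rewrite subr_ge0 -natrM ler_nat.
  apply: (@le_trans _ _ (- (3 * q%:R) * b ^+ N)).
    by rewrite mulNr lerN2 ler_wpM2l ?mulr_ge0// ler_weXn2l// ltnW.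
  by rewrite ler_wpM2r ?exprn_ge0// lerDr.
have K0 : 0 < K by rewrite exprn_gt0.
have B0 : 0 <= B.
  by rewrite -(joint_ex_cst mu1 P1 0); apply: joint_ex_le.
move: AB; rewrite natrM => AB Wle.
have qB : 0 <= q%:R * B by rewrite mulr_ge0.
have {}Wle : q%:R * (K * W) <= q%:R * (20 * (K * delta) + 3 * b ^+ (3 * q)).
  have bE : (1/10 : R) * (6/5) * b = 18 / 125 by rewrite /b; lra.
  move: AB; rewrite bE; move: Wle; lra.
move: Wle; rewrite ler_pM2l// -ler_pdivlMl// => /le_trans; apply.
rewrite mulrDr lerD//.
  by rewrite [20 * (K * _)]mulrCA mulKf// gt_eqF.
rewrite mulrCA -exprVn ler_pM2l//.
rewrite /K (_ : 4 * q = 3 * q + q)%N; last lia.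
by rewrite exprD invfM mulrAC mulVf ?mul1r ?exprVn// expf_neq0// gt_eqF.
Qed.

Lemma chernoff (R : realType) (q : nat) (X : finType) (mu : X -> R)
    (bad : pred X) :
  (forall x, 0 <= mu x) -> \sum_x mu x = 1 ->
  \sum_x mu x * (bad x)%:R <= 1/10 ->
  \sum_(r : {ffun 'I_(20 * q) -> X}) product_pr mu r *
     (4 * q <= \sum_j (bad (r j) : nat))%N%:R <= ((11/10) ^+ 20 / 16) ^+ q.
Proof.
move=> mu0 mu1 badp.
apply: (@le_trans _ _ (\sum_(r : {ffun 'I_(20 * q) -> X}) product_pr mu r *
  (16 ^- q * \prod_j 2 ^+ bad (r j)))).
  apply: ler_sum => r _; rewrite ler_wpM2l ?product_pr_ge0//.
  rewrite prodrXr ler_pdivlMl ?exprn_gt0//.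
  case: leqP => [le|_]; last by rewrite mulr0 exprn_ge0.
  rewrite mulr1 (_ : 16 = 2 ^+ 4); last by rewrite -natrX.
  by rewrite -exprM ler_weXn2l// ler1n.
under eq_bigr do rewrite mulrCA.
rewrite -mulr_sumr (product_pr_sum _ mu (fun x => 2 ^+ bad x)).
rewrite mulrC expr_div_n ler_pM2r ?invr_gt0 ?exprn_gt0//.
have S0 : 0 <= \sum_x mu x * 2 ^+ bad x.
  by apply: sumr_ge0 => x _; rewrite mulr_ge0// exprn_ge0.
have S1 : \sum_x mu x * 2 ^+ bad x <= 11/10.
  have -> : \sum_x mu x * 2 ^+ bad x = 1 + \sum_x mu x * (bad x)%:R.
    rewrite -[X in X + _]mu1 -big_split/=; apply: eq_bigr => x _.
    by case: (bad x); rewrite /= ?expr1 ?expr0; ring.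
  by lra.
rewrite exprM !lerXn2r// ?nnegrE ?exprn_ge0//; lra.
Qed.

Lemma few_paths_generalization (R : realType) (q n L : nat) (X V : finType)
    (mu : X -> R) (P : {ffun 'I_(20 * q) -> X} -> n.-tuple V -> R)
    (bad : n.-tuple V -> pred X) (z : V) :
  (forall x, 0 <= mu x) -> \sum_x mu x = 1 ->
  (forall r t, 0 <= P r t <= 1) ->
  (forall r t, P r t != 0 -> (changes z t <= L)%N) ->
  (forall t, \sum_x mu x * (bad t x)%:R <= 1/10) -> (0 < n)%N ->
  joint_ex mu P (fun r t => (4 * q <= num_bad bad t r)%N%:R) <=
    (n * #|V|)%:R ^+ L * expR 1 * ((11/10) ^+ 20 / 16) ^+ q.
Proof.
move=> mu0 mu1 P01 Pch badp n0.
have V0 : (0 < #|V|)%N by apply/card_gt0P; exists z.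
pose x : R := (n * #|V|)%:R^-1.
have nV0 : (0 < n * #|V|)%N by rewrite muln_gt0 n0.
have x0 : 0 < x by rewrite invr_gt0 ltr0n.
have x1 : x <= 1 by rewrite invf_le1 ?ltr0n// ler1n.
set c := ((11/10) ^+ 20 / 16) ^+ q.
have c0 : 0 <= c by rewrite exprn_ge0// divr_ge0// exprn_ge0//; lra.
apply: (@le_trans _ _ ((\sum_(t : n.-tuple V | (changes z t <= L)%N) 1) * c)).
  rewrite /joint_ex; under eq_bigr do rewrite mulr_sumr.
  rewrite exchange_big/= mulr_suml [leRHS]big_mkcond/=; apply: ler_sum => t _.
  have [tL|tL] := leqP (changes z t) L; last first.
    rewrite big1// => r _; have [->|/Pch] := eqVneq (P r t) 0; first by ring.
    by rewrite leqNgt tL.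
  rewrite mul1r; apply: le_trans (chernoff q mu0 mu1 (badp t)).
  apply: ler_sum => r _; rewrite ler_wpM2l ?product_pr_ge0//.
  by rewrite ler_piMl//; case/andP: (P01 r t).
rewrite ler_wpM2r//.
have x01 : 0 < x <= 1 by rewrite x0.
apply: le_trans (few_changes_count L n z x01) _.
rewrite -exprVn invrK ler_wpM2l ?exprn_ge0//.
have -> : #|V|%:R * x = n%:R^-1.
  by rewrite /x natrM invfM mulrCA mulfV ?mulr1// pnatr_eq0 -lt0n.
apply: (@le_trans _ _ (expR n%:R^-1 ^+ n)).
  by rewrite lerXn2r ?nnegrE ?expR_ge0 ?addr_ge0 ?invr_ge0// expR_ge1Dx.
by rewrite -expRM_natl mulfV// pnatr_eq0 -lt0n.
Qed.

Section Mechanism.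
Variables (R : realType) (q n L : nat) (X V : finType) (mu : X -> R).
Variables (K : {ffun 'I_(20 * q) -> X} -> seq V -> V -> R).
Variables (bad : n.-tuple V -> pred X) (z : V) (D delta : R).
Hypothesis mu_ge0 : forall x, 0 <= mu x.
Hypothesis mu_sum1 : \sum_x mu x = 1.
Hypothesis K_ge0 : forall r h v, 0 <= K r h v.
Hypothesis K_sum1 : forall r h, \sum_v K r h v = 1.
Hypothesis K_frozen : forall r h v,
  K r h v != 0 -> (L <= changes z h)%N -> v = last z h.
Hypothesis K_close : forall r j x h v,
  `|K r h v - K (update_at r j x) h v| <= D * K r h v.
Hypothesis bad_le : forall t, \sum_x mu x * (bad t x)%:R <= 1/10.

Lemma many_flips_generalization (th : nat) :
  (0 < q)%N -> (0 < th)%N -> 0 <= D -> th%:R * D <= 1/4 ->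
  joint_ex mu (fun r (t : n.-tuple V) => path_pr (K r) [::] t)
     (fun r t => (4 * q <= num_bad bad t r)%N%:R) <=
    20 * ((6/5) ^- th * (1 - 8 * th%:R ^+ 2 * D ^+ 2) ^- L) + 3 * (6/5) ^- q.
Proof.
move=> q0 th0 D0 thD.
have D14 : D <= 1/4 by apply: le_trans thD; rewrite ler_peMl// ler1n.
set w := 1 - _.
have w01 : 0 < w <= 1.
  have : (th%:R * D) ^+ 2 <= (1/4) ^+ 2.
    by rewrite lerXn2r// nnegrE ?mulr_ge0//; lra.
  have : 0 <= (th%:R * D) ^+ 2 by rewrite sqr_ge0.
  by rewrite /w -mulrA -exprMn; lra.
apply: private_generalization => //.
- by move=> r t; apply: path_pr_ge0.
- by move=> r; apply: path_pr_sum1.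
move=> r j x; apply: (@privacy_loss _ _ _ _ z) => //.
- move=> h v; apply: contraNneq => K'0; have := K_close r j x h v.
  rewrite K'0 subr0 ger0_norm// => le; rewrite -normr_le0 ger0_norm//.
  by have := K_ge0 r h v; nra.
- by lra.
- by move=> h; apply: moment_step.
by move=> t t0; exact: (frozen_changes (@K_frozen r) t0 (leq0n _)).
Qed.

Lemma few_flips_generalization :
  (0 < n)%N ->
  joint_ex mu (fun r (t : n.-tuple V) => path_pr (K r) [::] t)
     (fun r t => (4 * q <= num_bad bad t r)%N%:R) <=
    (n * #|V|)%:R ^+ L * expR 1 * ((11/10) ^+ 20 / 16) ^+ q.
Proof.
apply: (few_paths_generalization (z := z)) => //.
  by move=> r t; rewrite path_pr_ge0//= path_pr_le1.
by move=> r t t0; exact: (frozen_changes (@K_frozen r) t0 (leq0n _)).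
Qed.
End Mechanism.

(** * Softmax and the grid of output values *)

Definition softmax (R : realType) (V : finType) (b : R) (e : V -> nat) (v : V) : R :=
  b ^+ e v / \sum_v' b ^+ e v'.

Section Softmax.
Variables (R : realType) (V : finType) (b : R).
Hypothesis b1 : 1 <= b.
Implicit Types e : V -> nat.

Lemma softmax_ge0 e v : 0 <= softmax b e v.
Proof.
have b0 : 0 <= b by apply: le_trans b1.
by rewrite divr_ge0 ?exprn_ge0 ?sumr_ge0// => ? _; rewrite exprn_ge0.
Qed.

Lemma partition_gt0 e (z : V) : 0 < \sum_v b ^+ e v.
Proof.
have b0 : 0 < b by apply: lt_le_trans b1.
rewrite (bigD1 z)//= ltr_pwDl ?exprn_gt0// sumr_ge0// => v _.
by rewrite exprn_ge0// ltW.
Qed.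

Lemma softmax_sum1 e (z : V) : \sum_v softmax b e v = 1.
Proof. by rewrite -mulr_suml mulfV// gt_eqF// partition_gt0. Qed.

Lemma softmax_close e e' v :
  (forall v, e v <= (e' v).+1)%N -> (forall v, e' v <= (e v).+1)%N ->
  `|softmax b e v - softmax b e' v| <= (b ^+ 2 - 1) * softmax b e v.
Proof.
have b0 : 0 < b by apply: lt_le_trans b1.
have ratio e1 e2 : (forall v, e1 v <= (e2 v).+1)%N ->
    (forall v, e2 v <= (e1 v).+1)%N -> softmax b e1 v <= b ^+ 2 * softmax b e2 v.
  move=> le12 le21; rewrite /softmax ler_pdivrMr ?partition_gt0//.
  set S2 := \sum_v _; set S1 := \sum_v _.
  have -> : b ^+ 2 * (b ^+ e2 v / S2) * S1 = b ^+ (e2 v).+1 * (b * S1 / S2).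
    by rewrite [in RHS]exprS; ring.
  apply: (@le_trans _ _ (b ^+ (e2 v).+1)); first by rewrite ler_weXn2l.
  rewrite ler_peMr ?exprn_ge0 ?(ltW b0)//.
  rewrite ler_pdivlMr ?partition_gt0// mul1r mulr_sumr.
  by apply: ler_sum => w _; rewrite -exprS ler_weXn2l.
move=> le le'; have := ratio _ _ le le'; have := ratio _ _ le' le.
have := softmax_ge0 e v; have := softmax_ge0 e' v.
have : 1 <= b ^+ 2 by rewrite exprn_ege1.
move: (softmax b e v) (softmax b e' v) (b ^+ 2) => x y B B1 y0 x0 yx xy.
have [xy'|xy'] := leP y x.
  rewrite ger0_norm ?subr_ge0//.
  have : (B - 1) * y <= (B - 1) * x by rewrite ler_wpM2l// subr_ge0.
  lra.
by rewrite ltr0_norm ?subr_lt0//; lra.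
Qed.

Lemma softmax_failure e (k : nat) :
  \sum_(v | ~~ [forall v', e v' <= e v + k]%N) softmax b e v <= #|V|%:R * b ^- k.
Proof.
have b0 : 0 < b by apply: lt_le_trans b1.
rewrite mulr_natl -sumr_const big_mkcond/=; apply: ler_sum => v _.
case: ifP => [|_]; last by rewrite invr_ge0 exprn_ge0// ltW.
rewrite negb_forall => /existsP[v']; rewrite -ltnNge => lt.
rewrite /softmax ler_pdivrMr ?partition_gt0// ler_pdivlMl ?exprn_gt0//.
apply: (@le_trans _ _ (b ^+ e v')).
  by rewrite -exprD addnC ler_weXn2l// ltnW.
by rewrite [leRHS](bigD1 v')//= lerDl sumr_ge0// => w _; rewrite exprn_ge0// ltW.
Qed.

End Softmax.

Lemma ln1D_ge (R : realType) (x : R) : 0 <= x <= 1 -> x / 2 <= ln (1 + x).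
Proof.
move=> /andP[x0 x1]; rewrite -[leLHS]expRK ler_ln ?posrE ?expR_gt0//; last lra.
have : 1 - x / 2 <= expR (- (x / 2)) by exact: expR_ge1Dx.
rewrite expRN => le; have e0 : 0 < expR (x / 2) by rewrite expR_gt0.
have {}le : (1 - x / 2) * expR (x / 2) <= 1.
  by rewrite -ler_pdivlMr// div1r.
have : (1 + x) * ((1 - x / 2) * expR (x / 2)) <= (1 + x) * 1.
  by rewrite ler_wpM2l//; lra.
have : 0 <= (x / 2) * (1 - x) * expR (x / 2) by rewrite !mulr_ge0//; lra.
lra.
Qed.

Lemma geometric_approx (R : realType) (a b x : R) (I : nat) :
  0 < a -> 0 < b -> a <= x -> x <= a * (1 + b) ^+ I ->
  exists2 i : nat, (i <= I)%N & approx b x (a * (1 + b) ^+ i).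
Proof.
move=> a0 b0 ax xI.
have ex : exists i, x <= a * (1 + b) ^+ i by exists I.
have x0 : 0 < x by apply: lt_le_trans ax.
case: (ex_minnP ex) => i xi imin; exists i; first exact: imin.
rewrite /approx (ger0_norm (ltW x0)) ger0_norm ?subr_ge0//.
case: i xi imin => [|i] xi imin.
  rewrite expr0 mulr1; move: xi; rewrite expr0 mulr1 => xa.
  by rewrite (@le_trans _ _ 0) ?subr_le0// mulr_ge0// ltW.
have : a * (1 + b) ^+ i < x.
  by rewrite ltNge; apply/negP => /imin; rewrite ltnn.
rewrite exprS mulrCA.
move: (a * (1 + b) ^+ i) => y yx; have : b * y <= b * x by rewrite ler_wpM2l// ltW.
lra.
Qed.

Lemma value_grid (R : realType) (n : nat) (c b : R) :
  (0 < n)%N -> 0 < c -> 0 < b <= 1 ->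
  exists s : seq R, [/\ (0 < size s)%N, (size s)%:R <= 8 * c * ln n%:R / b + 5 &
    forall x, poly_range n c x -> exists2 v, v \in s & approx b x v].
Proof.
move=> n0 c0 /andP[b0 b1].
have ln0 : 0 <= ln n%:R :> R by rewrite ln_ge0// ler1n.
pose Y : R := 4 * c * ln n%:R / b.
have Y0 : 0 <= Y by rewrite divr_ge0 ?mulr_ge0 ?(ltW c0)// ltW.
pose I := (Num.truncn Y).+1.
have IY : I%:R <= Y + 1 by rewrite /I -natr1 lerD2r truncn_le.
have YI : Y < I%:R by exact: truncnS_gt.
pose a : R := (n%:R `^ c)^-1.
have nc0 : 0 < n%:R `^ c :> R by rewrite powR_gt0// ltr0n.
have a0 : 0 < a by rewrite invr_gt0.
pose p := [seq a * (1 + b) ^+ i | i <- iota 0 I.+1].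
pose s := 0 :: p ++ [seq - y | y <- p].
have b10 : 0 < 1 + b by lra.
have top : n%:R `^ c <= a * (1 + b) ^+ I.
  rewrite /a ler_pdivlMl// -ler_ln ?posrE ?mulr_gt0 ?exprn_gt0//.
  rewrite lnM ?posrE// ln_powR lnXn// -[_ *+ I]mulr_natl.
  apply: (@le_trans _ _ (Y * (b / 2))).
    by rewrite /Y le_eqVlt; apply/orP; left; apply/eqP; field; rewrite gt_eqF.
  apply: ler_pM => //; [by rewrite divr_ge0// ltW| exact: ltW|].
  by apply: ln1D_ge; rewrite ltW.
have pos x : a <= x <= n%:R `^ c -> exists2 v, v \in p & approx b x v.
  move=> /andP[ax xn]; have [|i iI ap] := geometric_approx a0 b0 ax (I := I).
    exact: le_trans top.
  by exists (a * (1 + b) ^+ i) => //; apply/mapP; exists i => //; rewrite mem_iota.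
exists s; split => //.
  have -> : size s = (2 * I + 3)%N.
    rewrite -[size s]/((size (p ++ [seq - y | y <- p])).+1).
    by rewrite size_cat !size_map size_iota; lia.
  rewrite natrD natrM.
  have -> : 8 * c * ln n%:R / b = 2 * Y by rewrite /Y; ring.
  lra.
move=> x [/andP[x1 x2]|->|/pos[v vp ap]].
- have [|v vp ap] := pos (- x); first by rewrite lerNr x2 lerNl.
  exists (- v).
    by rewrite inE mem_cat; apply/orP; right; apply/orP; right; apply/mapP; exists v.
  by move: ap; rewrite /approx opprK normrN -opprD normrN.
- by exists 0; rewrite ?inE ?eqxx// /approx subrr normr0 mulr0.
- by exists v => //; rewrite inE mem_cat vp orbT.
Qed.

(** * The robust algorithm *)

Section Runs.
Variables (R : realType) (n : nat) (A : stream_alg R n).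

Fixpoint final (s : memory A) (a : seq (update n)) (w : seq (coin A)) : memory A :=
  match a, w with
  | u :: a', x :: w' => final (step s u x).1 a' w'
  | _, _ => s
  end.

Definition estimate (w : seq (coin A)) (a : seq (update n)) : R :=
  if w is x :: w' then last 0 (unzip2 (run (init x) a w')) else 0.

Lemma final_rcons s a u w x : size w = size a ->
  final s (rcons a u) (rcons w x) = (step (final s a w) u x).1.
Proof. by elim: a s w => [|? a IH] s [|? w] //= [/IH->]. Qed.

Lemma last_run y s a u w x w' : size w = size a ->
  last y (unzip2 (run s (rcons a u) (w ++ x :: w'))) = (step (final s a w) u x).2.
Proof.
by elim: a y s w => [|? a IH] y s [|? w] //= [/IH].
Qed.

End Runs.

Section Robustification.
Variables (R : realType) (n : nat) (A : stream_alg R n) (q L : nat) (V : finType).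
Variables (val : V -> R) (z0 : V) (beta b : R).
Hypothesis b1 : 1 <= b.

(* Keeping z is made easier than moving to v, both by a wider window and by a
   bonus, so that z is left only when g has really moved. *)
Definition close (z v : V) (y : R) : bool :=
  approx (if v == z then 7 * beta else 5 / 2 * beta) y (val v).

Definition score (y : 'I_(20 * q) -> R) (z v : V) : nat :=
  (\sum_j (close z v (y j) : nat) + 8 * q * (v == z))%N.

Lemma score_le y z v : (score y z v < (28 * q).+1)%N.
Proof.
have le : (\sum_j (close z v (y j) : nat) <= 20 * q)%N.
  rewrite -[leqRHS]muln1 -[X in (X * 1)%N]card_ord -sum_nat_const.
  by apply: leq_sum => j _; apply: leq_b1.
by rewrite /score; case: (v == z); lia.
Qed.

Notation scores := {ffun V -> 'I_(28 * q).+1}.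
Definition score_table y z : scores := [ffun v => Ordinal (score_le y z v)].

(* One independent softmax draw for every possible table of scores: the coins
   of a round may not depend on the state. *)
Notation draw := {ffun scores -> V}.
Definition draw_pr (w : draw) : R :=
  \prod_(d : scores) softmax b (fun v => d v : nat) (w d).

Lemma draw_marginal (d : scores) (f : V -> R) :
  \sum_(w : draw) draw_pr w * f (w d) =
  \sum_v softmax b (fun v => d v : nat) v * f v.
Proof.
pose G (d' : scores) v :=
  softmax b (fun v => d' v : nat) v * (if d' == d then f v else 1).
transitivity (\prod_d' \sum_v G d' v); last first.
  rewrite (bigD1 d)//= [X in _ * X]big1 ?mulr1.
    by apply: eq_bigr => v _; rewrite /G eqxx.
  move=> d' /negPf d'd; under eq_bigr do rewrite /G d'd mulr1.
  exact: softmax_sum1.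
rewrite bigA_distr_bigA; apply: eq_bigr => w _; rewrite big_split /=.
congr (_ * _); rewrite (bigD1 d)//= eqxx big1 ?mulr1// => d' /negPf ->.
by [].
Qed.

Lemma draw_sum1 : \sum_w draw_pr w = 1.
Proof.
pose d : scores := [ffun => ord0].
rewrite -[RHS](softmax_sum1 b1 (fun v => d v : nat) z0).
have := draw_marginal d (fun=> 1).
under eq_bigr do rewrite mulr1; move=> ->.
by apply: eq_bigr => v _; rewrite mulr1.
Qed.

Definition rcoin : finType := ({ffun 'I_(20 * q) -> coin A} * draw)%type.
Definition rcoin_pr (x : rcoin) : R := product_pr (@coin_pr _ _ A) x.1 * draw_pr x.2.

Lemma rcoin_pr_ge0 x : 0 <= rcoin_pr x.
Proof.
rewrite mulr_ge0 ?product_pr_ge0//; first exact: coin_pr_ge0.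
by apply: prodr_ge0 => d _; apply: softmax_ge0.
Qed.

Lemma rcoin_pr_sum1 : \sum_x rcoin_pr x = 1.
Proof.
rewrite -(pair_bigA _ (fun x w => product_pr (@coin_pr _ _ A) x * draw_pr w))/=.
under eq_bigr do rewrite -mulr_sumr draw_sum1 mulr1.
by rewrite product_pr_sum1// coin_pr_sum1.
Qed.

(* The counter stops all changes after the first L, so that the bound L on their
   number holds surely and not only when the copies are accurate. *)
Definition rmemory : finType :=
  ({ffun 'I_(20 * q) -> memory A} * V * 'I_L.+1)%type.

Definition rinit (x : rcoin) : rmemory := ([ffun j => init (x.1 j)], z0, ord0).

Definition rstep (s : rmemory) (u : update n) (x : rcoin) : rmemory * R :=
  let: (M, z, c) := s in
  let y j := (step (M j) u (x.1 j)).2 in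
  let v := if (c < L)%N then x.2 (score_table y z) else z in
  (([ffun j => (step (M j) u (x.1 j)).1], v, inord (c + (v != z))), val v).

Definition robustify : stream_alg R n :=
  StreamAlg rcoin_pr_ge0 rcoin_pr_sum1 rinit rstep.

Section Game.
Variable adv : adversary R n.

Fixpoint game (h : transcript R n) (t : seq V) : transcript R n :=
  if t is v :: t' then game (rcons h (adv h, val v)) t' else h.

Lemma game_rcons h t v :
  game h (rcons t v) = rcons (game h t) (adv (game h t), val v).
Proof. by elim: t h => //= x t IH h. Qed.

Lemma size_game h t : size (game h t) = (size h + size t)%N.
Proof.
by elim: t h => [|x t IH] h /=; rewrite ?addn0// IH size_rcons addnS.
Qed.

Definition played (t : seq V) : seq (update n) :=
  rcons (unzip1 (game [::] t)) (adv (game [::] t)).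

Definition kern (w : 'I_(20 * q) -> seq (coin A)) (t : seq V) (v : V) : R :=
  if (changes z0 t < L)%N
  then softmax b (score (fun j => estimate (w j) (played t)) (last z0 t)) v
  else (v == last z0 t)%:R.

Definition coin_row (W : seq {ffun 'I_(20 * q) -> coin A}) (j : 'I_(20 * q)) :=
  [seq x j | x : {ffun 'I_(20 * q) -> coin A} <- W].

Lemma play_expectation (F : transcript R n -> R) (k : nat)
    (x0 : {ffun 'I_(20 * q) -> coin A}) (X : seq {ffun 'I_(20 * q) -> coin A})
    (t : seq V) (M : {ffun 'I_(20 * q) -> memory A}) (c : 'I_L.+1) :
  size X = size t -> c = changes z0 t :> nat ->
  (forall j, M j = final (init (x0 j)) (unzip1 (game [::] t)) (coin_row X j)) ->
  \sum_(w : k.-tuple rcoin) iid rcoin_pr w *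
     F (play (A := robustify) adv (game [::] t) (M, last z0 t, c) w) =
  \sum_(Y : k.-tuple {ffun 'I_(20 * q) -> coin A}) 
     iid (product_pr (@coin_pr _ _ A)) Y *
     \sum_(s : k.-tuple V) path_pr (kern (coin_row (x0 :: X ++ Y))) t s *
        F (game [::] (t ++ s)).
Proof.
elim: k X t M c => [|k IH] X t M c sX ct Mj.
  rewrite (sum_tuple_nil (fun w => iid rcoin_pr w * F (play (A := robustify)
    adv (game [::] t) (M, last z0 t, c) w))).
  rewrite (sum_tuple_nil (fun Y => iid (product_pr (@coin_pr _ _ A)) Y *
     \sum_(s : 0.-tuple V) path_pr (kern (coin_row (x0 :: X ++ Y))) t s *
        F (game [::] (t ++ s)))).
  rewrite (sum_tuple_nil (fun s => path_pr (kern (coin_row (x0 :: X ++ [::]))) t s *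
        F (game [::] (t ++ s)))) /=.
  by rewrite /iid !big_nil !mul1r cats0.
rewrite (sum_tuple_cons k (fun w => iid rcoin_pr w * F (play (A := robustify)
    adv (game [::] t) (M, last z0 t, c) w))).
rewrite (sum_tuple_cons k (fun Y => iid (product_pr (@coin_pr _ _ A)) Y *
     \sum_(s : k.+1.-tuple V) path_pr (kern (coin_row (x0 :: X ++ Y))) t s *
        F (game [::] (t ++ s)))).
pose f (p : rcoin) := \sum_(t0 : k.-tuple rcoin) iid rcoin_pr (p :: t0) *
  F (play (A := robustify) adv (game [::] t) (M, last z0 t, c) (p :: t0)).
transitivity (\sum_x \sum_(w : draw) f (x, w)).
  by rewrite (pair_bigA _ (fun x w => f (x, w))); apply: eq_bigr => -[].
rewrite /f {f}.
apply: eq_bigr => x _.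
set u := adv (game [::] t); set z := last z0 t.
pose y j := (step (M j) u (x j)).2.
pose G v := \sum_(Y : k.-tuple {ffun 'I_(20 * q) -> coin A}) 
     iid (product_pr (@coin_pr _ _ A)) Y *
     \sum_(s : k.-tuple V)
        path_pr (kern (coin_row (x0 :: rcons X x ++ Y))) (rcons t v) s *
        F (game [::] (rcons t v ++ s)).
pose K v := if (c < L)%N then softmax b (score y z) v else (v == z)%:R.
have szr j : size (coin_row X j) = size (unzip1 (game [::] t)).
  by rewrite !size_map size_game sX.
have kernE Y v : kern (coin_row (x0 :: X ++ x :: Y)) t v = K v.
  rewrite /kern /K -ct; case: ifP => // _; congr (softmax b (score _ _) v).
  apply/funext => j; rewrite /estimate /played /coin_row /= map_cat /=.
  by rewrite last_run -/(coin_row X j)// /y Mj.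
have step1 w : \sum_(t0 : k.-tuple rcoin) iid rcoin_pr ((x, w) :: t0) *
     F (play (A := robustify) adv (game [::] t) (M, z, c) ((x, w) :: t0)) =
   product_pr (@coin_pr _ _ A) x * (draw_pr w *
     G (if (c < L)%N then w (score_table y z) else z)).
  set v := if _ then _ else _.
  under eq_bigr do rewrite iid_cons -mulrA.
  rewrite -mulr_sumr {1}/rcoin_pr /= -mulrA; congr (_ * (_ * _)).
  rewrite -/v -/u -/y.
  have := IH (rcons X x) (rcons t v) [ffun j => (step (M j) u (x j)).1]
    (inord (c + (v != z))).
  rewrite last_rcons game_rcons; apply.
  - by rewrite !size_rcons sX.
  - rewrite changes_rcons -ct inordK// ltnS /v.
    case: ifP => [cL|_]; last by rewrite eqxx addn0 -ltnS.
    by case: (_ != _); rewrite ?addn1 ?addn0// ltnW.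
  - move=> j; rewrite ffunE /coin_row /unzip1 !map_rcons /= final_rcons.
      by rewrite Mj.
    exact: szr.
rewrite (eq_bigr _ (fun w _ => step1 w)) -mulr_sumr.
under [RHS]eq_bigr do rewrite iid_cons -mulrA.
rewrite -[RHS]mulr_sumr; congr (_ * _).
transitivity (\sum_v K v * G v).
  rewrite /K; case: (c < L)%N.
    rewrite (draw_marginal (score_table y z) G).
    apply: eq_bigr => v _; congr (softmax b _ v * _).
    by apply/funext => v'; rewrite ffunE.
  rewrite -mulr_suml draw_sum1 mul1r (bigD1 z)//= eqxx mul1r big1 ?addr0//.
  by move=> v /negPf ->; rewrite mul0r.
rewrite /G; under eq_bigr do rewrite mulr_sumr.
rewrite exchange_big /=; apply: eq_bigr => Y _.
rewrite (sum_tuple_cons k (fun s => path_pr (kern (coin_row (x0 :: X ++ x :: Y))) t s *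
        F (game [::] (t ++ s)))) /= mulr_sumr.
apply: eq_bigr => v _; rewrite mulrCA; congr (_ * _).
rewrite mulr_sumr; apply: eq_bigr => s _.
by rewrite kernE !cat_rcons mulrA.
Qed.

End Game.
End Robustification.

Lemma coins_pr_iid (R : realType) (n : nat) (A : stream_alg R n) (m : nat)
    (E : pred (seq (coin A))) :
  coins_pr (fun w : m.+1.-tuple (coin A) => E w) =
  \sum_(w : m.+1.-tuple (coin A)) iid (@coin_pr _ _ A) w * (E w)%:R.
Proof.
rewrite /coins_pr big_mkcond/=; apply: eq_bigr => w _.
by rewrite /iid big_tuple; case: (E w); rewrite ?mulr1 ?mulr0.
Qed.

Lemma iid_product_transpose (R : realType) (k m : nat) (C : finType) (mu : C -> R)
    (G : ('I_k -> seq C) -> R) :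
  \sum_(W : m.-tuple {ffun 'I_k -> C}) iid (product_pr mu) W *
     G (fun j => [seq x j | x : {ffun 'I_k -> C} <- W]) =
  \sum_(r : {ffun 'I_k -> m.-tuple C}) product_pr (fun w : m.-tuple C => iid mu w) r *
     G (fun j => r j).
Proof.
pose f (W : m.-tuple {ffun 'I_k -> C}) : {ffun 'I_k -> m.-tuple C} :=
  [ffun j => map_tuple (fun x : {ffun 'I_k -> C} => x j) W].
pose f' (r : {ffun 'I_k -> m.-tuple C}) : m.-tuple {ffun 'I_k -> C} :=
  [tuple [ffun j => tnth (r j) i] | i < m].
have fK : cancel f f'.
  move=> W; apply: eq_from_tnth => i; rewrite tnth_mktuple.
  by apply/ffunP => j; rewrite !ffunE tnth_map.
have f'K : cancel f' f.
  move=> r; apply/ffunP => j; apply: eq_from_tnth => i.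
  by rewrite ffunE tnth_map tnth_mktuple ffunE.
rewrite [RHS](reindex f); last by exists f' => ? _; [exact: fK|exact: f'K].
apply: eq_bigr => W _; congr (_ * _).
  rewrite /iid /product_pr exchange_big/=; apply: eq_bigr => j _.
  by rewrite ffunE /= big_map.
by congr G; apply/funext => j; rewrite ffunE.
Qed.

Section RobustifyTheory.
Variables (R : realType) (n : nat) (A : stream_alg R n) (q L : nat) (V : finType).
Variables (val : V -> R) (z0 : V) (beta b : R).
Hypothesis b1 : 1 <= b.
Variable adv : adversary R n.

Local Notation B := (robustify A q L val z0 beta b1).
Local Notation law := (@kern R n A q L V val z0 beta b adv).
Local Notation game := (game val adv).

Lemma coins_pr_robustify (m : nat) (F : pred (transcript R n)) :
  coins_pr (fun w : m.+1.-tuple (coin B) =>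
    F (play adv [::] (init (thead w)) (behead w))) =
  joint_ex (fun w : m.+1.-tuple (coin A) => iid (@coin_pr _ _ A) w)
    (fun r (t : m.-tuple V) => path_pr (law (fun j => r j)) [::] t)
    (fun r t => (F (game [::] t))%:R).
Proof.
pose E (w : seq (coin B)) :=
  if w is x :: w' then F (play adv [::] (init x) w') else false.
transitivity (coins_pr (fun w : m.+1.-tuple (coin B) => E w)).
  apply: eq_bigl => w; case/tupleP: w => x w.
  by rewrite theadE.
rewrite coins_pr_iid (sum_tuple_cons m (fun w => iid (@coin_pr _ _ B) w * (E w)%:R)).
rewrite /joint_ex -(iid_product_transpose m.+1 (@coin_pr _ _ A) (fun r =>
   \sum_(t : m.-tuple V) path_pr (law r) [::] t * (F (game [::] t))%:R)).
rewrite (sum_tuple_cons m (fun W => iid (product_pr (@coin_pr _ _ A)) W *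
   \sum_(t : m.-tuple V) path_pr (law (coin_row W)) [::] t *
     (F (game [::] t))%:R)).
pose H x := \sum_(Y : m.-tuple {ffun 'I_(20 * q) -> coin A})
   iid (product_pr (@coin_pr _ _ A)) Y *
   \sum_(t : m.-tuple V) path_pr (law (coin_row (x :: Y))) [::] t *
     (F (game [::] t))%:R.
transitivity (\sum_(x : coin B) rcoin_pr b x * H x.1).
  apply: eq_bigr => x _; under eq_bigr do rewrite iid_cons -mulrA.
  rewrite -mulr_sumr; congr (_ * _).
  have := @play_expectation R n A q L V val z0 beta b b1 adv (fun h => (F h)%:R)
    m x.1 [::] [::] [ffun j => init (x.1 j)] ord0.
  apply => // j.
  by rewrite ffunE.
transitivity (\sum_x \sum_(w : {ffun {ffun V -> 'I_(28 * q).+1} -> V})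
   product_pr (@coin_pr _ _ A) x * draw_pr b w * H x).
  by rewrite (pair_bigA _ (fun x w =>
    product_pr (@coin_pr _ _ A) x * draw_pr b w * H x)).
apply: eq_bigr => x _; rewrite -mulr_suml -mulr_sumr draw_sum1// mulr1.
rewrite /H mulr_sumr; apply: eq_bigr => Y _.
by rewrite iid_cons mulrA.
Qed.

Lemma kern_ge0 w t v : 0 <= law w t v.
Proof. by rewrite /kern; case: (_ < L)%N => //; apply: softmax_ge0. Qed.

Lemma kern_sum1 w t : \sum_v law w t v = 1.
Proof.
rewrite /kern; case: (_ < L)%N; first exact: softmax_sum1.
by rewrite (bigD1 (last z0 t))//= eqxx big1 ?addr0// => v /negPf->.
Qed.

Lemma kern_frozen w t v :
  law w t v != 0 -> (L <= changes z0 t)%N -> v = last z0 t.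
Proof.
move=> + Lc; rewrite /kern ltnNge Lc /=.
by case: (v =P last z0 t) => // _; rewrite eqxx.
Qed.

Lemma score_update (y y' : 'I_(20 * q) -> R) j z v :
  (forall i, i != j -> y i = y' i) ->
  (score val beta y z v <= (score val beta y' z v).+1)%N.
Proof.
move=> yy'; rewrite /score -addSn leq_add2r.
rewrite (bigD1 j)//= [in leqRHS](bigD1 j)//=.
rewrite (eq_bigr (fun i => close val beta z v (y' i) : nat)); last first.
  by move=> i ij; rewrite yy'.
by case: (close _ _ _ _ _); rewrite ?add1n ?add0n; lia.
Qed.

Lemma kern_close (r : {ffun 'I_(20 * q) -> seq (coin A)}) r' j t v : 
  (forall i, i != j -> r i = r' i) ->
  `|law r t v - law r' t v| <= (b ^+ 2 - 1) * law r t v.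
Proof.
move=> rr'; rewrite /kern; case: (_ < L)%N.
  by apply: softmax_close => // w; apply: (@score_update _ _ j) => i ij; rewrite rr'.
by rewrite subrr normr0 mulr_ge0// subr_ge0 exprn_ege1.
Qed.

Definition step_ok (w : 'I_(20 * q) -> seq (coin A)) (t : seq V) (v : V) : bool :=
  let y j := estimate (w j) (played val adv t) in
  if (changes z0 t < L)%N
  then [forall v', score val beta y (last z0 t) v' <=
          score val beta y (last z0 t) v + q]%N
  else v == last z0 t.

Lemma kern_step_failure w t :
  \sum_(v | ~~ step_ok w t v) law w t v <= #|V|%:R * b ^- q.
Proof.
have b0 : 0 < b by apply: lt_le_trans b1.
rewrite /step_ok /kern; case: (changes z0 t < L)%N => /=.
  exact: softmax_failure.
rewrite big1; first by rewrite mulr_ge0// invr_ge0 exprn_ge0// ltW.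
by move=> v /negPf->.
Qed.

End RobustifyTheory.

(** * Accuracy of the outputs *)

Section ApproxTheory.
Variable R : realType.
Implicit Types b g x y z : R.

Lemma approx_norm b g y : 0 < b <= 1/10 -> approx b g y ->
  9/10 * `|g| <= `|y| <= 11/10 * `|g|.
Proof.
rewrite /approx => /andP[b0 b1] yg.
have : b * `|g| <= 1/10 * `|g| by rewrite ler_wpM2r.
have := ler_normD (y - g) g; have := ler_normD (g - y) y.
by rewrite !subrK [`|g - y|]distrC; lra.
Qed.

Lemma approx_common b g x y : 0 < b <= 1/10 -> approx b g y -> approx b g x ->
  approx (5/2 * b) y x.
Proof.
move=> b01 yg; have /andP[y1 _] := approx_norm b01 yg.
move: yg; rewrite /approx => yg xg; have /andP[b0 _] := b01.
have := ler_wpM2l (ltW b0) y1; have := ler_distD g x y.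
have by0 : 0 <= b * `|y| by rewrite mulr_ge0// ltW.
by rewrite [`|g - y|]distrC; lra.
Qed.

Lemma approx_via b c1 c2 g y z : 0 < b <= 1/10 -> 0 <= c1 ->
  1 + 11/10 * c1 <= c2 ->
  approx b g y -> approx (c1 * b) y z -> approx (c2 * b) g z.
Proof.
move=> b01 c10 c12 yg; have /andP[_ y1] := approx_norm b01 yg.
move: yg; rewrite /approx => yg zy; have /andP[b0 _] := b01.
have c1b : 0 <= c1 * b by rewrite mulr_ge0// ltW.
have := ler_wpM2l c1b y1; have := ler_distD y z g.
have bg : 0 <= b * `|g| by rewrite mulr_ge0// ltW.
have := ler_wpM2r bg c12; lra.
Qed.

Lemma approx_shift b c1 c2 g y z : 0 < b <= 1/10 -> 0 <= c1 ->
  c1 + 1 <= 9/10 * c2 ->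
  approx b g y -> approx (c1 * b) g z -> approx (c2 * b) y z.
Proof.
move=> b01 c10 c12 yg; have /andP[y1 _] := approx_norm b01 yg.
move: yg; rewrite /approx => yg zy; have /andP[b0 _] := b01.
have c2b : 0 <= c2 * b by rewrite mulr_ge0 ?ltW//; lra.
have := ler_wpM2l c2b y1; have := ler_distD g z y.
rewrite [`|g - y|]distrC.
have bg : 0 <= b * `|g| by rewrite mulr_ge0// ltW.
have := ler_wpM2r bg c12; lra.
Qed.
End ApproxTheory.

Lemma sum_close_le (k : nat) (good c : pred 'I_k) :
  (forall j, good j -> ~~ c j) ->
  (\sum_j (c j : nat) <= \sum_j (~~ good j : nat))%N.
Proof.
move=> gc; apply: leq_sum => j _; have := gc j.
by case: (good j) => [/(_ isT) /negPf->|_] //=; apply: leq_b1.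
Qed.

Lemma sum_close_ge (k : nat) (good c : pred 'I_k) :
  (forall j, good j -> c j) ->
  (k <= \sum_j (c j : nat) + \sum_j (~~ good j : nat))%N.
Proof.
move=> gc; rewrite -big_split/= -[leqLHS]muln1 -[X in (X * 1)%N]card_ord.
rewrite -sum_nat_const; apply: leq_sum => j _; have := gc j.
by case: (good j) => [/(_ isT)->|_]; rewrite ?addn1.
Qed.

Section Accuracy.
Variables (R : realType) (q L m : nat) (V : finType) (val : V -> R) (z0 : V).
Variables (beta : R) (G : nat -> R) (y : nat -> 'I_(20 * q) -> R).
Variables (good : pred 'I_(20 * q)) (t : seq V).

Local Notation flip := [rel i j | (i < j)%N && ~~ approx beta (G i) (G j)].
Local Notation score := (score val beta).

Hypothesis q_gt0 : (0 < q)%N.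
Hypothesis beta01 : 0 < beta <= 1/10.
Hypothesis good_many : (\sum_j (~~ good j : nat) < 4 * q)%N.
Hypothesis good_approx : forall i j, (i < m)%N -> good j ->
  approx beta (G i.+1) (y i j).
Hypothesis grid : forall i, (i <= m)%N -> exists v, approx beta (G i) (val v).
Hypothesis init_approx : approx beta (G 0) (val z0).
Hypothesis steps : forall i, (i < m)%N ->
  if (changes z0 (take i t) < L)%N
  then forall v', (score (y i) (last z0 (take i t)) v' <=
         score (y i) (last z0 (take i t)) (nth z0 t i) + q)%N
  else nth z0 t i = last z0 (take i t).
Hypothesis flips_le : forall idx, all (fun i => i <= m)%N idx ->
  sorted flip idx -> (size idx <= L.+1)%N.
Hypothesis size_t : size t = m.

Let invariant i := exists2 idx, size idx = (changes z0 (take i t)).+1 &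
  [/\ all (fun j => j <= i)%N idx, sorted flip idx &
      approx (15/4 * beta) (G (last 0%N idx)) (val (last z0 (take i t)))].

Lemma exists_good (c : pred 'I_(20 * q)) :
  (4 * q <= \sum_j (c j : nat))%N -> exists2 j, good j & c j.
Proof.
move=> le; apply: contrapT => no.
have : (\sum_j (c j : nat) <= \sum_j (~~ good j : nat))%N.
  by apply: sum_close_le => j gj; apply/negP => cj; apply: no; exists j.
by lia.
Qed.

Lemma accuracy_step i : (i < m)%N -> invariant i ->
  invariant i.+1 /\ approx (10 * beta) (G i.+1) (val (nth z0 t i)).
Proof.
move=> im [idx szi [idxi sidx ap]].
have := steps im; set z := last z0 (take i t) in ap *; set v := nth z0 t i.
have tE : take i.+1 t = rcons (take i t) v by rewrite (take_nth z0)// size_t.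
rewrite /invariant tE changes_rcons last_rcons -/z => st.
have idxi1 : all (fun j => j <= i.+1)%N idx.
  by apply: sub_all idxi => j /leqW.
have [v1 v1g] := grid im.
have v1close j : good j -> close val beta z v1 (y i j).
  move=> gj; rewrite /close; have yg := good_approx im gj.
  have := approx_common beta01 yg v1g; rewrite /approx; case: ifP => // _ /le_trans.
  by apply; rewrite ler_wpM2r// ler_wpM2r//; [case/andP: beta01 => /ltW|lra].
have v1score : (16 * q < score (y i) z v1)%N.
  have := sum_close_ge (c := fun j => close val beta z v1 (y i j)) v1close.
  by rewrite /score; lia.
have selected : (changes z0 (take i t) < L)%N -> v != z ->
    exists2 j, good j & approx (5/2 * beta) (y i j) (val v).
  move=> cL vz; move: st; rewrite cL => /(_ v1).
  rewrite {2}/score (negPf vz) muln0 addn0 => le.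
  have [|j gj] := @exists_good (fun j => close val beta z v (y i j)); first by lia.
  by rewrite /close (negPf vz) => cj; exists j.
have kept : (changes z0 (take i t) < L)%N -> v = z ->
    exists2 j, good j & approx (7 * beta) (y i j) (val v).
  move=> cL vz; move: st; rewrite cL => /(_ v1).
  rewrite {2}/score vz eqxx muln1 => le.
  have [|j gj] := @exists_good (fun j => close val beta z z (y i j)); first by lia.
  by rewrite /close eqxx => cj; exists j.
case: (boolP (approx beta (G (last 0%N idx)) (G i.+1))) => near.
  have zg : approx (132/25 * beta) (G i.+1) (val z).
    by apply: approx_shift near ap => //; lra.
  have vz : v = z.
    move: st; case: ifP => // cL /(_ z) le; apply/eqP/negPn/negP => vz.
    have : (20 * q <= \sum_j (close val beta z z (y i j) : nat) +
        \sum_j (~~ good j : nat))%N.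
      apply: sum_close_ge => j gj; rewrite /close eqxx.
      by apply: approx_shift (good_approx im gj) zg => //; lra.
    move: le; rewrite /score eqxx (negPf vz) muln0 muln1 addn0.
    have : (\sum_j (close val beta z v (y i j) : nat) <= 20 * q)%N.
      rewrite -[leqRHS]muln1 -[X in (X * 1)%N]card_ord -sum_nat_const.
      by apply: leq_sum => j _; apply: leq_b1.
    by move: good_many; clear -q_gt0; lia.
  split; first by exists idx; rewrite ?vz ?eqxx ?addn0.
  move: zg; rewrite vz /approx => /le_trans; apply.
  by rewrite ler_wpM2r// ler_wpM2r//; [case/andP: beta01 => /ltW|lra].
have chain : all (fun j => j <= i.+1)%N (rcons idx i.+1) /\
    sorted flip (rcons idx i.+1).
  rewrite all_rcons leqnn idxi1; split => //.
  case: (idx) szi idxi sidx near => //= x s _ /andP[xi si] sx near.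
  rewrite rcons_path sx /= near andbT ltnS.
  by have := mem_last x s; rewrite inE => /orP[/eqP->//|/(allP si)].
have cL : (changes z0 (take i t) < L)%N.
  have := flips_le _ chain.2; rewrite size_rcons szi; apply.
  by apply: sub_all chain.1 => j /leq_trans; apply.
have [vz|vz] := eqVneq v z.
  split; first by exists idx; rewrite ?vz ?eqxx ?addn0.
  have [j gj] := kept cL vz; rewrite vz => zj.
  by apply: approx_via (good_approx im gj) zj => //; lra.
have [j gj vj] := selected cL vz.
have vg : approx (15/4 * beta) (G i.+1) (val v).
  by apply: approx_via (good_approx im gj) vj => //; lra.
split.
  exists (rcons idx i.+1); first by rewrite size_rcons szi addn1.
  by case: chain => ? ?; rewrite last_rcons.
move: vg; rewrite /approx => /le_trans; apply.
by rewrite ler_wpM2r// ler_wpM2r//; [case/andP: beta01 => /ltW|lra].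
Qed.

Lemma outputs_accurate i : (i < m)%N -> approx (10 * beta) (G i.+1) (val (nth z0 t i)).
Proof.
have inv0 : invariant 0.
  exists [:: 0%N]; rewrite take0//=; split => //.
  move: init_approx; rewrite /approx => /le_trans; apply.
  by rewrite ler_wpM2r// -[leLHS]mul1r ler_wpM2r//; [case/andP: beta01 => /ltW|lra].
have inv : (i <= m)%N -> invariant i.
  elim: i => // i IH im; apply: (accuracy_step im _).1; apply: IH; exact: ltnW.
by move=> im; apply: (accuracy_step im (inv (ltnW im))).2.
Qed.

End Accuracy.

Section Flips.
Variables (R : realType) (n m : nat) (b : R) (g : seq (update n) -> R).

Lemma flips_le_flip_number l : flips b m g l -> (l <= flip_number b m g)%N.
Proof.
move=> fl; have lm : (l < m.+2)%N.
  case: fl => a [idx [<- idxm sidx]]; rewrite ltnS -(size_iota 0 m.+1).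
  have us : sorted ltn idx.
    by apply: sub_sorted sidx => i j /= /andP[].
  apply: uniq_leq_size; first exact: (sorted_uniq ltn_trans ltnn).
  by move=> i /(allP idxm); rewrite mem_iota add0n ltnS.
by apply: (leq_bigmax_cond (Ordinal lm)); apply/asboolP.
Qed.

Lemma flip_number_gt0 : (0 < n)%N -> (0 < flip_number b m g)%N.
Proof.
move=> n0; apply: flips_le_flip_number.
by exists [tuple (Ordinal n0, 0) | _ < m], [:: 0%N].
Qed.

Lemma flip_number_le : (flip_number b m g <= m.+1)%N.
Proof. by apply/bigmax_leqP => l _; rewrite -ltnS. Qed.

End Flips.

Lemma unzip1_run (R : realType) n (A : stream_alg R n) s a (w : seq (coin A)) :
  size w = size a -> unzip1 (run s a w) = a.
Proof. by elim: a s w => [|u a IH] s [|x w] //= [/IH->]. Qed.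

Lemma size_run (R : realType) n (A : stream_alg R n) s a (w : seq (coin A)) :
  size w = size a -> size (run s a w) = size a.
Proof. by move=> wa; rewrite -(size_map fst) -/unzip1 unzip1_run. Qed.

Lemma last_run_take (R : realType) n (A : stream_alg R n) s a (w : seq (coin A)) i d :
  size w = size a -> (i < size a)%N ->
  last d (unzip2 (run s (take i.+1 a) w)) = nth 0 (unzip2 (run s a w)) i.
Proof.
elim: a s w i d => [|u a IH] s [|x w] [|i] d //= [wa]; first by rewrite take0.
by rewrite ltnS => ia; rewrite -(IH (step s u x).1 w i (step s u x).2).
Qed.

Lemma all_steps_nth (V : Type) (ok : seq V -> V -> bool) (z : V) h t i :
  all_steps ok h t -> (i < size t)%N -> ok (h ++ take i t) (nth z t i).
Proof.
elim: t h i => //= v t IH h [|i] /andP[okv okt]; first by rewrite cats0.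
by rewrite ltnS => /(IH _ _ okt); rewrite cat_rcons.
Qed.

Section GameTheory.
Variables (R : realType) (n : nat) (V : finType) (val : V -> R) (adv : adversary R n).
Local Notation game := (game val adv).

Lemma game_cat h s t : game h (s ++ t) = game (game h s) t.
Proof. by elim: s h => //= v s IH h. Qed.

Lemma unzip2_game h t : unzip2 (game h t) = unzip2 h ++ map val t.
Proof.
elim: t h => [|v t IH] h /=; first by rewrite cats0.
by rewrite IH /unzip2 map_rcons cat_rcons.
Qed.

Lemma take_game h t : take (size h) (unzip1 (game h t)) = unzip1 h.
Proof.
elim: t h => [|v t IH] h /=; first by rewrite take_oversize// size_map.
have := IH (rcons h (adv h, val v)); rewrite size_rcons /unzip1 map_rcons /=.
have sz : (size h <= size (map fst (game (rcons h (adv h, val v)) t)))%N.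
  by rewrite size_map size_game size_rcons; lia.
move=> /(congr1 (take (size h))); rewrite take_takel// => ->.
by rewrite -cats1 take_cat size_map ltnn subnn take0 cats0.
Qed.

Lemma played_take t i : (i < size t)%N ->
  played val adv (take i t) = take i.+1 (unzip1 (game [::] t)).
Proof.
case: t => // v0 t' ; set t := v0 :: t' => it.
have sz : size (game [::] (take i.+1 t)) = i.+1.
  by rewrite size_game size_takel.
rewrite -[in RHS](cat_take_drop i.+1 t) game_cat -{1}sz take_game.
by rewrite (take_nth v0)// game_rcons /played /unzip1 map_rcons.
Qed.

End GameTheory.

Section Correctness.
Variables (R : realType) (n : nat) (A : stream_alg R n) (q L m : nat) (V : finType).
Variables (val : V -> R) (z0 : V) (beta b : R) (g : seq (update n) -> R).
Variable adv : adversary R n.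
Hypothesis q_gt0 : (0 < q)%N.
Hypothesis beta01 : 0 < beta <= 1/10.
Hypothesis grid : forall a : seq (update n), (size a <= m)%N ->
  exists v, approx beta (g a) (val v).
Hypothesis init_approx : approx beta (g [::]) (val z0).
Hypothesis flips_le : (flip_number beta m g <= L.+1)%N.

Local Notation game := (game val adv).

Definition inaccurate (t : m.-tuple V) : pred (m.+1.-tuple (coin A)) :=
  fun x => ~~ accurate beta g
     (run (init (thead x)) (unzip1 (game [::] t)) (behead x)).

Lemma game_accurate (r : {ffun 'I_(20 * q) -> m.+1.-tuple (coin A)})
    (t : m.-tuple V) :
  (num_bad inaccurate t r < 4 * q)%N ->
  all_steps (step_ok L val z0 beta adv (fun j => r j)) [::] t ->
  accurate (10 * beta) g (game [::] t).
Proof.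
move=> few ok; set a := unzip1 (game [::] t).
have sa : size a = m by rewrite size_map size_game size_tuple.
have pl i : (i < m)%N -> played val adv (take i t) = take i.+1 a.
  by move=> im; rewrite played_take// size_tuple.
apply/allP => i; rewrite mem_iota add0n /= size_game size_tuple => im.
rewrite unzip2_game /= (nth_map z0) ?size_tuple//.
apply: (@outputs_accurate _ q L m V val z0 beta (fun i => g (take i a))
  (fun i j => estimate (r j) (take i.+1 a)) (fun j => ~~ inaccurate t (r j)) t) => //.
- by under eq_bigr do rewrite negbK.
- move=> i' j im'; rewrite negbK -/a; case/tupleP: (r j) => x w.
  rewrite theadE /= => acc; have wa : size w = size a by rewrite sa size_tuple.
  move/allP: acc => /(_ i'); rewrite mem_iota add0n /= size_run// sa => /(_ im').
  by rewrite unzip1_run// -(last_run_take _ 0)// sa.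
- by move=> i' im'; apply: grid; rewrite size_takel// sa.
- by rewrite take0.
- move=> i' im'; have := all_steps_nth z0 ok (i := i'); rewrite size_tuple => /(_ im').
  rewrite /step_ok /= pl//; case: (_ < L)%N; last by move/eqP.
  by move=> /forallP.
- move=> idx idxm sidx; apply: leq_trans flips_le; apply: flips_le_flip_number.
  have sa' : size a == m by rewrite sa.
  by exists (Tuple sa'), idx.
by rewrite size_tuple.
Qed.

Lemma inaccurate_pr (t : m.-tuple V) : oblivious_correct beta (9/10) m g A ->
  \sum_(x : m.+1.-tuple (coin A)) iid (@coin_pr _ _ A) x * (inaccurate t x)%:R <= 1/10.
Proof.
have sa : size (unzip1 (game [::] t)) == m.
  by rewrite size_map size_game size_tuple.
move=> /(_ (Tuple sa)); rewrite /coins_pr /= => good_ge.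
have total := iid_sum1 m.+1 (@coin_pr_sum1 _ _ A).
rewrite (bigID (fun x => inaccurate t x))/= in total.
have -> : \sum_(x : m.+1.-tuple (coin A)) iid (@coin_pr _ _ A) x * (inaccurate t x)%:R =
   \sum_(x : m.+1.-tuple (coin A) | inaccurate t x) iid (@coin_pr _ _ A) x.
  rewrite [RHS]big_mkcond/=; apply: eq_bigr => x _.
  by case: (inaccurate t x); rewrite ?mulr1 ?mulr0.
move: good_ge; set good := \sum_(w | _) _ => good_ge.
suff : \sum_(x : m.+1.-tuple (coin A) | ~~ inaccurate t x)
    iid (@coin_pr _ _ A) x = good by move: total good_ge; lra.
apply: eq_big => [x|x _]; first by rewrite negbK.
by rewrite /iid big_tuple.
Qed.

End Correctness.

(** * Choice of the parameters *)

Section RobustifyCorrect.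
Variables (R : realType) (n : nat) (A : stream_alg R n) (q L m : nat) (V : finType).
Variables (val : V -> R) (z0 : V) (beta b delta : R) (g : seq (update n) -> R).
Hypothesis b1 : 1 <= b.
Hypothesis q_gt0 : (0 < q)%N.
Hypothesis m_gt0 : (0 < m)%N.
Hypothesis beta01 : 0 < beta <= 1/10.
Hypothesis grid : forall a : seq (update n), (size a <= m)%N ->
  exists v, approx beta (g a) (val v).
Hypothesis init_approx : approx beta (g [::]) (val z0).
Hypothesis flips_le : (flip_number beta m g <= L.+1)%N.
Hypothesis correct : oblivious_correct beta (9/10) m g A.
Hypothesis softmax_small : m%:R * (#|V|%:R * b ^- q) <= delta / 2.
Hypothesis generalizes :
  (exists th : nat, [/\ (0 < th)%N, th%:R * (b ^+ 2 - 1) <= 1/4 &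
     20 * ((6/5) ^- th * (1 - 8 * th%:R ^+ 2 * (b ^+ 2 - 1) ^+ 2) ^- L) +
     3 * (6/5) ^- q <= delta / 2]) \/
  (m * #|V|)%:R ^+ L * expR 1 * ((11/10) ^+ 20 / 16) ^+ q <= delta / 2.

Lemma robustify_correct :
  robust_correct (10 * beta) (1 - delta) m g (robustify A q L val z0 beta b1).
Proof.
move=> adv.
rewrite (coins_pr_robustify A q L val z0 beta b1 adv m
  (fun h => accurate (10 * beta) g h)).
pose mu (w : m.+1.-tuple (coin A)) := iid (@coin_pr _ _ A) w.
have mu0 w : 0 <= mu w by apply: iid_ge0; exact: coin_pr_ge0.
have mu1 : \sum_w mu w = 1 by apply: iid_sum1; exact: coin_pr_sum1.
pose K (r : {ffun 'I_(20 * q) -> m.+1.-tuple (coin A)}) :=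
  kern L val z0 beta b adv (fun j => r j).
have K0 r h v : 0 <= K r h v by apply: kern_ge0.
have K1 r h : \sum_v K r h v = 1 by apply: kern_sum1.
have D0 : 0 <= b ^+ 2 - 1 by rewrite subr_ge0 exprn_ege1.
pose bad := @inaccurate R n A m V val beta g adv.
have bad_le t : \sum_x mu x * (bad t x)%:R <= 1/10 by apply: inaccurate_pr.
have Kfr r h v : K r h v != 0 -> (L <= changes z0 h)%N -> v = last z0 h.
  exact: kern_frozen.
have Kcl r j x h v :
    `|K r h v - K (update_at r j x) h v| <= (b ^+ 2 - 1) * K r h v.
  pose f (r : {ffun 'I_(20 * q) -> m.+1.-tuple (coin A)}) :
    {ffun 'I_(20 * q) -> seq (coin A)} := [ffun j => r j : seq _].
  have KE r' : K r' = kern L val z0 beta b adv (f r').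
    by rewrite /K; congr kern; apply/funext => i; rewrite ffunE.
  rewrite !KE; apply: (@kern_close _ _ _ _ _ _ _ _ _ _ b1 _ _ _ j).
  by move=> i /negPf ij; rewrite !ffunE ij.
pose P r (t : m.-tuple V) := path_pr (K r) [::] t.
have P0 r t : 0 <= P r t by apply: path_pr_ge0.
have P1 r : \sum_t P r t = 1 by apply: path_pr_sum1.
have few : joint_ex mu P (fun r t => (4 * q <= num_bad bad t r)%N%:R) <= delta / 2.
  case: generalizes => [[th [th0 thD]]|]; apply: le_trans.
    exact: (many_flips_generalization mu0 mu1 K0 K1 Kfr Kcl).
  exact: (few_flips_generalization mu0 mu1 K0 K1 Kfr).
have ok : joint_ex mu P (fun r t => (~~ all_steps
    (step_ok L val z0 beta adv (fun j => r j)) [::] t)%:R) <= delta / 2.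
  rewrite -[leRHS](joint_ex_cst mu1 P1); apply: ler_sum => r _.
  rewrite ler_wpM2l ?product_pr_ge0// -mulr_suml P1 mul1r.
  apply: le_trans softmax_small; apply: step_failure; [exact: K0|exact: K1|].
  by move=> h; exact: (kern_step_failure L val z0 beta b1 adv _ h).
rewrite lerBlDr -[leLHS](joint_ex_cst mu1 P1).
apply: (@le_trans _ _ (joint_ex mu P (fun r t =>
   (accurate (10 * beta) g (game val adv [::] t))%:R +
   ((4 * q <= num_bad bad t r)%N%:R + (~~ all_steps
    (step_ok L val z0 beta adv (fun j => r j)) [::] t)%:R)))).
  apply: joint_ex_le => // r t.
  have := @game_accurate R n A q L m V val z0 beta g adv q_gt0 beta01 grid
    init_approx flips_le r t.
  rewrite -/bad; case: leqP => [_ _|_ /(_ isT)].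
    by rewrite addrCA lerDl addr_ge0.
  case: (all_steps _ _ _) => [/(_ isT)->|_]; first by rewrite !addr0.
  by rewrite addrA lerDr addr_ge0.
rewrite joint_exD joint_exD lerD2l; move: few ok; lra.
Qed.

End RobustifyCorrect.

Lemma expR_le_ln (R : realType) (x y : R) : 0 < y -> x <= ln y -> expR x <= y.
Proof. by move=> y0 xy; rewrite -[leRHS]lnK ?posrE// ler_expR. Qed.

Section ParameterChoice.
Variables (R : realType) (q L m v : nat) (delta : R).
Hypothesis delta01 : 0 < delta < 1.
Hypothesis m_gt0 : (0 < m)%N.
Hypothesis v_gt0 : (0 < v)%N.

Let l : R := ln (80 / delta).
Let S : R := Num.sqrt (l * L.+1%:R).
Let X : R := ln (2 * m%:R * v%:R / delta).
Let eps : R := (400 * S)^-1.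

Hypothesis q_ge : 800 * S * X <= q%:R.

Lemma ln2_ge : 1/2 <= ln 2 :> R.
Proof. by have := @ln1D_ge R 1; rewrite (_ : 1 + 1 = 2)//; apply; lra. Qed.

Lemma delta_inv : 1 < delta^-1.
Proof. by case/andP: delta01 => d0 d1; rewrite invf_gt1. Qed.

Lemma l_ge1 : 1 <= l.
Proof.
have := ln2_ge => ln2; have := delta_inv => d1.
apply: (@le_trans _ _ (ln 2 + ln 2)); first lra.
rewrite -lnM ?posrE// /l ler_ln ?posrE//; lra.
Qed.

Lemma S_ge1 : 1 <= S.
Proof.
rewrite -[leLHS]sqrtr1 ler_wsqrtr// mulr_ege1 ?l_ge1// ler1n//.
Qed.

Lemma mv_ge1 : 1 <= m%:R * v%:R :> R.
Proof. by rewrite -natrM ler1n muln_gt0 m_gt0. Qed.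

Lemma X_ge : ln (2 / delta) <= X.
Proof.
have d := delta_inv; have mv := mv_ge1.
have d0 : 0 < delta^-1 by lra.
have mvd : 0 <= (m%:R * v%:R - 1) * delta^-1 by rewrite mulr_ge0//; lra.
rewrite ler_ln ?posrE; [lra|lra|].
by rewrite -mulrA in mvd *; lra.
Qed.

Lemma X_ge_half : 1/2 <= X.
Proof.
have d := delta_inv; apply: le_trans X_ge; apply: le_trans ln2_ge _.
by rewrite ler_ln ?posrE//; lra.
Qed.

Lemma ratio_ge1 : 1 <= 1 + eps.
Proof. by rewrite lerDl invr_ge0 mulr_ge0// (le_trans ler01 S_ge1). Qed.

Lemma SX_ge : X <= S * X.
Proof. by rewrite ler_peMl ?S_ge1// (le_trans _ X_ge_half)//; lra. Qed.

Lemma softmax_small_params :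
  m%:R * (v%:R * (1 + eps) ^- q) <= delta / 2.
Proof.
have S1 := S_ge1; have d1 := delta_inv; have mv := mv_ge1.
have /andP[d0 _] := delta01.
have e0 : 0 < eps by rewrite invr_gt0; lra.
have e1 : eps <= 1 by rewrite invf_le1; lra.
have b0 : 0 < 1 + eps by lra.
rewrite mulrA ler_pdivrMr ?exprn_gt0// -ler_pdivrMl ?divr_gt0//.
have -> : (delta / 2)^-1 * (m%:R * v%:R) = 2 * m%:R * v%:R / delta.
  by rewrite invf_div; ring.
have p0 : 0 < 2 * m%:R * v%:R / delta.
  by rewrite divr_gt0// -mulrA; lra.
rewrite -ler_ln ?posrE ?exprn_gt0// -/X lnXn// -[_ *+ q]mulr_natl.
have : eps / 2 <= ln (1 + eps) by apply: ln1D_ge; rewrite ltW.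
have q0 : 0 <= q%:R :> R by [].
move=> /(ler_wpM2l q0); apply: le_trans.
have : 800 * S * X * (eps / 2) <= q%:R * (eps / 2) by rewrite ler_wpM2r//; lra.
apply: le_trans.
rewrite le_eqVlt; apply/orP; left; apply/eqP; rewrite /eps; field.
by rewrite gt_eqF//; lra.
Qed.

Lemma tail_small_params : 3 * (6/5) ^- q <= delta / 4.
Proof.
have S1 := S_ge1; have d1 := delta_inv; have Xh := X_ge_half; have XS := SX_ge.
have /andP[d0 _] := delta01.
have q0 : 0 <= q%:R :> R by [].
rewrite ler_pdivrMr ?exprn_gt0//; last lra.
have : 12 / delta <= (6/5) ^+ q.
  apply: (@le_trans _ _ ((2 / delta) ^+ 4)).
    have -> : (2 / delta) ^+ 4 = 16 * (delta^-1 * delta^-1 * delta^-1) / delta by ring.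
    rewrite ler_pM2r ?invr_gt0//.
    have d2 : 1 <= delta^-1 * delta^-1 by rewrite mulr_ege1// ltW.
    have := mulr_ege1 d2 (ltW d1); lra.
  have p0 : 0 < 2 / delta by rewrite divr_gt0.
  have p1 : 0 < 6/5 :> R by lra.
  rewrite -ler_ln ?posrE ?exprn_gt0// !lnXn// -[_ *+ q]mulr_natl -[_ *+ 4]mulr_natl.
  have : (1/5) / 2 <= ln (6/5) :> R.
    by have := @ln1D_ge R (1/5); rewrite (_ : 1 + 1/5 = 6/5); [apply|]; lra.
  move=> /(ler_wpM2l q0); apply: le_trans.
  have := X_ge; move: q_ge Xh XS; rewrite -!mulrA; move: (S * X) X => SX x; lra.
rewrite ler_pdivrMr//; lra.
Qed.

Lemma many_flips_params : l <= L.+1%:R ->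
  exists th : nat, [/\ (0 < th)%N, th%:R * ((1 + eps) ^+ 2 - 1) <= 1/4 &
     20 * ((6/5) ^- th * (1 - 8 * th%:R ^+ 2 * ((1 + eps) ^+ 2 - 1) ^+ 2) ^- L) +
     3 * (6/5) ^- q <= delta / 2].
Proof.
move=> lL; have l1 := l_ge1; have S1 := S_ge1; have /andP[d0 d1] := delta01.
have e0 : 0 < eps by rewrite invr_gt0; lra.
have eS : eps * S = 1/400 by rewrite /eps; field; rewrite gt_eqF//; lra.
have e1 : eps <= 1 by rewrite invf_le1; lra.
have lS : l <= S.
  rewrite -[leLHS]ger0_norm; last lra.
  by rewrite -sqrtr_sqr ler_wsqrtr// expr2 ler_wpM2l//; lra.
have SS : S ^+ 2 = l * L.+1%:R by rewrite sqr_sqrtr// mulr_ge0//; lra.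
exists (Num.truncn (12 * l)).+1.
set th : R := (Num.truncn (12 * l)).+1%:R; set D := _ ^+ 2 - 1.
have th1 : 12 * l < th by apply: truncnS_gt.
have th2 : th <= 13 * l.
  apply: (@le_trans _ _ (12 * l + 1)); last lra.
  by rewrite /th -natr1 lerD2r truncn_le//; lra.
have De : 0 <= D <= 3 * eps.
  have : eps * eps <= 1 * eps by rewrite ler_wpM2r//; lra.
  have : 0 <= eps * eps by rewrite mulr_ge0; lra.
  by rewrite /D expr2; lra.
have /andP[D0 D3] := De.
have thD : th * D <= 39 * (l * eps).
  apply: (@le_trans _ _ (13 * l * (3 * eps))); last lra.
  by rewrite ler_pM//; lra.
have le : l * eps <= 1/400.
  by rewrite -eS mulrC ler_wpM2l//; lra.
have thD4 : th * D <= 1/4 by lra.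
have thD0 : 0 <= th * D by rewrite mulr_ge0//; lra.
split => //.
set et := 8 * th ^+ 2 * D ^+ 2.
have et_le : et <= 8 * (39 * (l * eps)) ^+ 2.
  by rewrite /et -mulrA -exprMn ler_pM2l// lerXn2r ?nnegrE//; lra.
have et0 : 0 <= et by rewrite /et -mulrA -exprMn mulr_ge0// sqr_ge0.
have le0 : 0 <= l * eps by rewrite mulr_ge0//; lra.
have et_half : et <= 1/2.
  apply: le_trans et_le _.
  have : (39 * (l * eps)) ^+ 2 <= (39/400) ^+ 2.
    by rewrite lerXn2r ?nnegrE//; lra.
  lra.
have etL : 2 * et * L%:R <= 1/5 * l.
  have L0 : 0 <= L%:R :> R by [].
  have LL : L%:R <= L.+1%:R :> R by rewrite ler_nat.
  have leL : l * (eps ^+ 2 * (l * L.+1%:R)) = l * (1/400 * (1/400)).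
    by rewrite -SS -exprMn eS; lra.
  have leL' : l * (eps ^+ 2 * (l * L%:R)) <= l * (1/400 * (1/400)).
    rewrite -leL ler_wpM2l//; first lra.
    rewrite ler_wpM2l ?sqr_ge0// ler_wpM2l//; lra.
  have := ler_wpM2r L0 et_le; lra.
have tail := tail_small_params.
set E := _ ^- _ * (1 - et) ^- L.
suff : E <= delta / 80.
  move=> le_E; rewrite (_ : delta / 2 = 20 * (delta / 80) + delta / 4).
    by rewrite lerD// ler_pM2l.
  by field.
rewrite /E.
have w0 : 0 < 1 - et by lra.
have -> : delta / 80 = expR (- l).
  by rewrite expRN lnK ?posrE ?divr_gt0// invf_div.
apply: (@le_trans _ _ (expR (- (6/5 * l)) * expR (1/5 * l))); last first.
  by rewrite -expRD ler_expR; lra.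
apply: ler_pM; rewrite ?invr_ge0 ?exprn_ge0//; [lra|lra| |].
  rewrite expRN lef_pV2 ?posrE ?expR_gt0 ?exprn_gt0//; last lra.
  apply: expR_le_ln; first by rewrite exprn_gt0//; lra.
  rewrite lnXn; last lra.
  rewrite -[_ *+ (Num.truncn _).+1]mulr_natl -/th.
  have : (1/5) / 2 <= ln (6/5) :> R.
    by have := @ln1D_ge R (1/5); rewrite (_ : 1 + 1/5 = 6/5); [apply|]; lra.
  have th0 : 0 <= th by lra.
  move=> /(ler_wpM2l th0); lra.
apply: (@le_trans _ _ (expR (2 * et) ^+ L)).
  rewrite -exprVn lerXn2r ?nnegrE ?expR_ge0 ?invr_ge0//; first lra.
  apply: le_trans (expR_ge1Dx _).
  rewrite -div1r ler_pdivrMr//.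
  have : 0 <= et * (1 - 2 * et) by rewrite mulr_ge0//; lra.
  lra.
by rewrite -expRM_natl ler_expR; lra.
Qed.

Lemma few_flips_params : L.+1%:R <= l ->
  (m * v)%:R ^+ L * expR 1 * ((11/10) ^+ 20 / 16) ^+ q <= delta / 2.
Proof.
move=> Ll; have l1 := l_ge1; have S1 := S_ge1; have /andP[d0 d1] := delta01.
have Xh := X_ge_half; have XS := SX_ge; have X2 := X_ge; have mv := mv_ge1.
have dinv := delta_inv.
have LS : L.+1%:R <= S.
  rewrite -[leLHS]ger0_norm// -sqrtr_sqr ler_wsqrtr// expr2 ler_wpM2r//.
have L0 : 0 <= L%:R :> R by [].
have mvX : ln (m%:R * v%:R) <= X.
  rewrite ler_ln ?posrE; [|lra|]; last first.
    by rewrite divr_gt0// -mulrA; lra.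
  have := mulr_ge0 (_ : 0 <= m%:R * v%:R) (_ : 0 <= delta^-1 - 1).
  by rewrite -[2 * _ * _]mulrA => /(_ _ _); lra.
have mvE : (m * v)%:R ^+ L = expR (L%:R * ln (m%:R * v%:R)) :> R.
  by rewrite expRM_natl lnK ?natrM// posrE; lra.
have c : (11/10) ^+ 20 / 16 <= expR (- (1/2)) :> R.
  by apply: le_trans (expR_ge1Dx _); lra.
apply: (@le_trans _ _ (expR (L%:R * ln (m%:R * v%:R)) * expR 1 * expR (- (1/2)) ^+ q)).
  rewrite mvE ler_wpM2l ?mulr_ge0 ?expR_ge0// lerXn2r ?nnegrE ?expR_ge0//; lra.
rewrite -expRM_natl -!expRD.
have -> : delta / 2 = expR (- ln (2 / delta)).
  by rewrite expRN lnK ?posrE ?divr_gt0// invf_div.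
rewrite ler_expR.
have LX : L%:R * ln (m%:R * v%:R) <= L%:R * X by rewrite ler_wpM2l.
have LSX : L.+1%:R * X <= S * X by rewrite ler_wpM2r//; lra.
move: LSX LX XS Xh X2 q_ge; rewrite -natr1 mulrDl mul1r -!mulrA.
move: (S * X) (L%:R * X) (L%:R * _) X (ln (2 / delta)) => *; lra.
Qed.

End ParameterChoice.

(** * Algorithms without memory *)

Section Stateless.
Variables (R : realType) (n : nat).

Lemma unit_pr_ge0 (x : unit) : 0 <= (1 : R). Proof. by []. Qed.

Lemma unit_pr_sum1 : \sum_(x : unit) (1 : R) = 1.
Proof. by rewrite sumr_const card_unit. Qed.

Definition stateless (f : update n -> R) : stream_alg R n :=
  StreamAlg unit_pr_ge0 unit_pr_sum1 (fun=> tt) (fun (_ : unit) u _ => (tt, f u)).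

Lemma space_stateless f : space_bits (stateless f) = 0.
Proof. by rewrite /space_bits card_unit ln1 mul0r. Qed.

Lemma size_play (A : stream_alg R n) adv h (s : memory A) w :
  size (play adv h s w) = (size h + size w)%N.
Proof.
elim: w h s => [|x w IH] h s /=; first by rewrite addn0.
by rewrite IH size_rcons addnS.
Qed.

Lemma play_stateless f adv h w s :
  all (fun p => p.2 == f p.1) h ->
  all (fun p => p.2 == f p.1) (play (A := stateless f) adv h s w).
Proof.
by elim: w h s => //= x w IH h s hh; apply: IH; rewrite all_rcons /= eqxx.
Qed.

Lemma stateless_robust (b p : R) (m : nat) (g : seq (update n) -> R) f : p <= 1 ->
  (forall a u, (size a < m)%N -> approx b (g (rcons a u)) (f u)) ->
  robust_correct b p m g (stateless f).
Proof.
move=> p1 gf adv; apply: le_trans p1 _; rewrite /coins_pr.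
rewrite (eq_bigl predT) => [|w].
  rewrite -[leLHS](iid_sum1 m.+1 (coin_pr_sum1 (stateless f))).
  by apply: ler_sum => w _; rewrite /iid big_tuple.
set h := play _ _ _ _.
have hs : size h = m by rewrite size_play size_behead size_tuple.
have hf : all (fun p => p.2 == f p.1) h by apply: play_stateless.
apply/allP => i; rewrite mem_iota add0n hs /= => im.
case E : h hs hf => [|[u0 y0] h'] hs hf; first by rewrite -hs in im.
rewrite -E in hs hf *.
have ih : (i < size (unzip1 h))%N by rewrite size_map hs.
rewrite (take_nth u0)// !(nth_map (u0, y0)) ?hs//.
have /(all_nthP (u0, y0)) /(_ i) := hf; rewrite hs => /(_ im) /eqP ->.
by apply: gf; rewrite size_takel// ltnW.
Qed.

End Stateless.

Lemma iid_marginal (R : realType) (T : finType) (mu : T -> R) (k i : nat) (x0 : T)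
    (f : T -> R) : \sum_x mu x = 1 -> (i < k)%N ->
  \sum_(w : k.-tuple T) iid mu w * f (nth x0 w i) = \sum_x mu x * f x.
Proof.
move=> mu1; elim: k i => // k IH [|i] ik.
  rewrite (sum_tuple_cons k (fun w => iid mu w * f (nth x0 w 0))).
  apply: eq_bigr => x _; under eq_bigr do rewrite iid_cons mulrAC /=.
  by rewrite -mulr_sumr iid_sum1// mulr1.
rewrite (sum_tuple_cons k (fun w => iid mu w * f (nth x0 w i.+1))).
rewrite -[RHS]mul1r -mu1 mulr_suml; apply: eq_bigr => x _.
under eq_bigr do rewrite iid_cons -mulrA /=.
by rewrite -mulr_sumr IH.
Qed.

Section OneState.
Variables (R : realType) (n m : nat) (A : stream_alg R n) (b : R).
Variable g : seq (update n) -> R.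
Hypothesis one : (#|memory A| <= 1)%N.
Hypothesis b01 : 0 < b <= 1/10.
Hypothesis correct : oblivious_correct b (9/10) m g A.

Lemma coin_inhabited : exists x : coin A, True.
Proof.
apply: contrapT => no; have /eqP := coin_pr_sum1 A.
rewrite big1 ?(eq_sym 0) ?oner_eq0// => x _.
by case: no; exists x.
Qed.

Lemma nth_run s a (w : seq (coin A)) x0 u0 i : size w = size a -> (i < size a)%N ->
  exists s', nth 0 (unzip2 (run s a w)) i = (step s' (nth u0 a i) (nth x0 w i)).2.
Proof.
elim: a s w i => [|u a IH] s [|x w] [|i] //= [wa]; first by exists s.
by rewrite ltnS => /(IH (step s u x).1 w i wa).
Qed.

Lemma one_state_step (s0 : memory A) a u : (size a < m)%N ->
  9/10 <= \sum_x coin_pr x * (approx b (g (rcons a u)) (step s0 u x).2)%:R.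
Proof.
move=> am; have [x0 _] := coin_inhabited.
pose c := rcons a u ++ nseq (m - (size a).+1) u.
have sc : size c == m by rewrite size_cat size_rcons size_nseq subnKC.
have /le_trans := correct (Tuple sc); apply.
rewrite -(iid_marginal x0 _ (coin_pr_sum1 A) (_ : ((size a).+1 < m.+1)%N))//.
rewrite /coins_pr big_mkcond/=; apply: ler_sum => w _.
rewrite -(big_tuple _ _ w predT (@coin_pr _ _ A)) -/(iid (@coin_pr _ _ A) w).
case: ifP => [|_]; last by rewrite mulr_ge0// iid_ge0//; exact: coin_pr_ge0.
case/tupleP: w => x w; rewrite theadE /= => acc.
have wc : size w = size c by rewrite (eqP sc) size_tuple.
move/allP: acc => /(_ (size a)); rewrite mem_iota add0n /= size_run// (eqP sc).
move=> /(_ am); rewrite unzip1_run//.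
have ac : (size a < size c)%N by rewrite (eqP sc).
have [s' ->] := nth_run (init x) x0 u wc ac.
have -> : take (size a).+1 c = rcons a u.
  by rewrite /c take_cat size_rcons ltnn subnn take0 cats0.
have -> : nth u c (size a) = u.
  by rewrite /c nth_cat size_rcons ltnSn nth_rcons ltnn eqxx.
have -> : s' = s0 by apply: (card_le1_eqP one).
by move=> ->; rewrite mulr1.
Qed.

Lemma one_state_approx a u : (size a < m)%N ->
  approx (10 * b) (g (rcons a u)) (g [:: u]).
Proof.
move=> am; have [x0 _] := coin_inhabited.
have m0 : (size (@nil (update n)) < m)%N by apply: leq_ltn_trans am.
have := one_state_step (init x0) u am; have := one_state_step (init x0) u m0.
rewrite /=; set p1 := \sum_x _; set p2 := \sum_x _ => h1 h2.
have [x [h1x h2x]] : exists x, approx b (g [:: u]) (step (init x0) u x).2 /\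
    approx b (g (rcons a u)) (step (init x0) u x).2.
  apply: contrapT => no; suff : p1 + p2 <= 1 by lra.
  rewrite -(coin_pr_sum1 A) /p1 /p2 -big_split/=; apply: ler_sum => x _.
  rewrite -mulrDr ler_piMr ?coin_pr_ge0// -natrD lern1.
  case E1 : (approx b (g [:: u]) _); case E2 : (approx b (g (rcons a u)) _) => //.
  by case: no; exists x.
have /andP[y1 _] := approx_norm b01 h1x; have /andP[_ y2] := approx_norm b01 h2x.
move: h1x h2x; rewrite /approx; set y := (step _ _ _).2 in y1 y2 *.
set g1 := g [:: u] in y1 *; set g2 := g (rcons a u) in y2 *.
have /andP[b0 _] := b01.
have := ler_distD y g1 g2; rewrite [`|g1 - y|]distrC.
have bg : 0 <= b * `|g2| by rewrite mulr_ge0// ltW.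
have := ler_wpM2l (ltW b0) y1; have := ler_wpM2l (ltW b0) y2.
lra.
Qed.

End OneState.

Lemma space_bits_ge1 (R : realType) n (A : stream_alg R n) :
  (1 < #|memory A|)%N -> 1 <= space_bits A.
Proof.
move=> A2; rewrite /space_bits ler_pdivlMr ?mul1r.
  by rewrite ler_ln ?posrE ?ltr0n ?ler_nat// (leq_trans _ A2).
by have := ln2_ge R; lra.
Qed.

Lemma space_robustify (R : realType) n (A : stream_alg R n) q L (V : finType)
    (val : V -> R) z0 beta b (b1 : 1 <= b) :
  (0 < #|memory A|)%N ->
  space_bits (robustify A q L val z0 beta b1) =
   (20 * q)%:R * space_bits A + (ln #|V|%:R + ln L.+1%:R) / ln 2.
Proof.
move=> A0; rewrite /space_bits /= !card_prod card_ffun !card_ord.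
have V0 : (0 < #|V|)%N by apply/card_gt0P; exists z0.
rewrite !natrM !lnM ?posrE ?mulr_gt0 ?ltr0n ?expn_gt0 ?A0//.
rewrite natrX lnXn ?ltr0n// -[_ *+ _]mulr_natl.
by ring.
Qed.

(** * The space bound *)

Section Constants.
Variables (R : realType) (c k1 delta0 : R).
Hypothesis c_gt0 : 0 < c.
Hypothesis k1_gt0 : 0 < k1.
Hypothesis delta0_01 : 0 < delta0 < 1.

Definition grid_const : R := 80 * c / k1 + 5.
Definition log_const : R := ln (2 * grid_const) / ln delta0^-1 + 2.
Definition sqrt_const : R := ln 80 / ln delta0^-1 + 1.
Definition space_const : R := 22 * (802 * Num.sqrt sqrt_const * log_const).

Lemma grid_const_ge : 5 <= grid_const.
Proof. by rewrite lerDr divr_ge0 ?mulr_ge0// ltW. Qed.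

Lemma ln_delta0_gt0 : 0 < ln delta0^-1.
Proof. by case/andP: delta0_01 => d0 d1; rewrite ln_gt0// invf_gt1. Qed.

Lemma log_const_gt0 : 0 < log_const.
Proof.
have := grid_const_ge => g5; rewrite ltr_wpDl// divr_ge0 ?(ltW ln_delta0_gt0)//.
by rewrite ln_ge0//; lra.
Qed.

Lemma sqrt_const_gt0 : 0 < sqrt_const.
Proof.
rewrite ltr_wpDl// divr_ge0 ?(ltW ln_delta0_gt0)// ln_ge0//; lra.
Qed.

Lemma space_const_gt0 : 0 < space_const.
Proof. by rewrite !mulr_gt0 ?log_const_gt0// sqrtr_gt0 sqrt_const_gt0. Qed.

Variables (n m v lam : nat) (alpha delta : R).
Hypothesis m_gt0 : (0 < m)%N.
Hypothesis v_gt0 : (0 < v)%N.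
Hypothesis log_nm : k1 * ln n%:R <= ln m%:R.
Hypothesis alpha01 : 0 < alpha < 1.
Hypothesis delta_gt0 : 0 < delta <= delta0.
Hypothesis v_le : v%:R <= 8 * c * ln n%:R / (alpha / 10) + 5.

Lemma ln_delta_ge : ln delta0^-1 <= ln (1 / delta).
Proof.
case/andP: delta_gt0 => d0 d; case/andP: delta0_01 => d00 _.
by rewrite div1r ler_ln ?posrE ?invr_gt0// lef_pV2 ?posrE.
Qed.

Lemma v_le_grid : v%:R <= grid_const * (m%:R / alpha).
Proof.
case/andP: alpha01 => a0 a1; apply: le_trans v_le _.
have m1 : 1 <= m%:R :> R by rewrite ler1n.
have lnm : ln m%:R <= m%:R :> R by rewrite ltW// ln_sublinear//; lra.
have lnn : ln n%:R <= m%:R / k1.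
  by rewrite ler_pdivlMr// mulrC (le_trans log_nm).
have ai : 1 <= alpha^-1 by rewrite invf_ge1// ltW.
have ma : 1 <= m%:R / alpha by rewrite mulr_ege1.
have c0 : 0 <= 80 * c / alpha by rewrite divr_ge0 ?mulr_ge0// ltW.
have := ler_wpM2l c0 lnn.
have -> : 8 * c * ln n%:R / (alpha / 10) = 80 * c / alpha * ln n%:R.
  by field; rewrite gt_eqF.
have -> : 80 * c / alpha * (m%:R / k1) = 80 * c / k1 * (m%:R / alpha).
  by field; rewrite !gt_eqF.
rewrite /grid_const mulrDl; lra.
Qed.

Lemma log_le : ln (2 * m%:R * v%:R / delta) <= log_const * ln (m%:R / (alpha * delta)).
Proof.
case/andP: alpha01 => a0 a1; case/andP: delta_gt0 => d0 d.
case/andP: delta0_01 => d00 d01; have l0 := ln_delta0_gt0.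
have m1 : 1 <= m%:R :> R by rewrite ler1n.
have ai : 1 <= alpha^-1 by rewrite invf_ge1// ltW.
have di : 1 <= delta^-1 by rewrite invf_ge1//; lra.
have v1 : 1 <= v%:R :> R by rewrite ler1n.
have g5 := grid_const_ge.
set Y := m%:R / (alpha * delta).
have YE : Y = m%:R * alpha^-1 * delta^-1 by rewrite /Y; field; rewrite !gt_eqF.
have Y0 : 0 < Y by rewrite divr_gt0 ?mulr_gt0//; lra.
have mai : 1 <= m%:R * alpha^-1 by rewrite mulr_ege1.
have WY : ln delta0^-1 <= ln Y.
  apply: le_trans ln_delta_ge _; rewrite div1r ler_ln ?posrE ?invr_gt0//.
  by rewrite YE ler_peMl// invr_ge0 ltW.
have le : 2 * m%:R * v%:R / delta <= 2 * grid_const * Y ^+ 2.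
  have -> : 2 * grid_const * Y ^+ 2 =
    2 * m%:R * (grid_const * (m%:R / alpha)) / delta * (alpha^-1 * delta^-1).
    by rewrite YE; field; rewrite !gt_eqF.
  apply: (@le_trans _ _ (2 * m%:R * (grid_const * (m%:R / alpha)) / delta)).
    rewrite ler_pM2r ?invr_gt0// ler_pM2l ?v_le_grid//; lra.
  rewrite ler_peMr ?mulr_ege1// divr_ge0 ?mulr_ge0 ?invr_ge0//; lra.
apply: (@le_trans _ _ (ln (2 * grid_const * Y ^+ 2))).
  have pY : 0 < 2 * grid_const * Y ^+ 2 by rewrite mulr_gt0 ?exprn_gt0//; lra.
  have pL : 0 < 2 * m%:R * v%:R / delta by rewrite divr_gt0 ?mulr_gt0//; lra.
  by rewrite ler_ln ?posrE.
rewrite lnM ?posrE ?exprn_gt0//; last lra.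
rewrite lnXn// /log_const -[ln Y *+ 2]mulr_natl [leRHS]mulrDl lerD2r.
rewrite mulrAC ler_pdivlMr// ler_wpM2l// ln_ge0//; lra.
Qed.

Lemma sqrt_le : Num.sqrt (ln (80 / delta) * lam%:R) <=
  Num.sqrt sqrt_const * Num.sqrt (lam%:R * ln (1 / delta)).
Proof.
case/andP: delta_gt0 => d0 d; have l0 := ln_delta0_gt0; have ld := ln_delta_ge.
have s0 := sqrt_const_gt0.
rewrite -sqrtrM; last exact: ltW.
rewrite ler_wsqrtr// [lam%:R * _]mulrC mulrA ler_wpM2r//.
rewrite -[80 / delta]/(80 * delta^-1) lnM ?posrE ?invr_gt0//.
rewrite div1r in ld *; rewrite /sqrt_const [leRHS]mulrDl mul1r lerD2r.
rewrite mulrAC ler_pdivlMr// ler_wpM2l// ln_ge0//; lra.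
Qed.
End Constants.

(* The constant C of the O(.) depends on the constants c, k1, k2 of the
   standing assumptions and on an upper bound delta0 < 1 for delta: as delta
   tends to 1 the factor log (1 / delta) vanishes, so no C is uniform there. *)
Theorem theorem3p4 (R : realType) (c k1 k2 delta0 : R)
    (hc : 0 < c) (hk1 : 0 < k1) (hk2 : 0 < k2) (hdelta0 : delta0 < 1) :
  exists C : R, 0 < C /\
    forall (n m : nat) (g : seq (update n) -> R) (alpha delta : R)
      (L : R -> R -> R) (A : stream_alg R n),
      k1 * ln n%:R <= ln m%:R <= k2 * ln n%:R ->
      0 < alpha -> 0 < delta <= delta0 ->
      (forall a : seq (update n), (size a <= m)%N -> poly_range n c (g a)) ->
      (forall (s : memory A) (u : update n) (x : coin A),
          poly_range n c (step s u x).2) ->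
      space_bits A <= L (alpha / 10) (1 / 10) ->
      oblivious_correct (alpha / 10) (9 / 10) m g A ->
      exists B : stream_alg R n,
        robust_correct alpha (1 - delta) m g B /\
        space_bits B <= C * `| L (alpha / 10) (1 / 10)
                        * Num.sqrt ((flip_number (alpha / 10) m g)%:R
                                    * ln (1 / delta))
                        * ln (m%:R / (alpha * delta)) |.
Proof.
have [d00|d00] := leP delta0 0.
  exists 1; split => // n m g alpha delta L A _ _ /andP[d0 d].
  by move: (lt_le_trans d0 (le_trans d d00)); rewrite ltxx.
have d001 : 0 < delta0 < 1 by rewrite d00.
have C0 := space_const_gt0 hc hk1 d001.
exists (space_const c k1 delta0); split => // n m g alpha delta L A.
move=> /andP[lnm _] a0 dd grange _ spA corr.
have /andP[d0 d] := dd.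
have p1 : 1 - delta <= 1 by lra.
have al : 10 * (alpha / 10) = alpha by field.
set L0 := L _ _ in spA *; set lam := flip_number _ _ _.
have trivial_case f :
    (forall a u, (size a < m)%N -> approx alpha (g (rcons a u)) (f u)) ->
    exists B : stream_alg R n, robust_correct alpha (1 - delta) m g B /\
      space_bits B <= space_const c k1 delta0 * `| L0
        * Num.sqrt (lam%:R * ln (1 / delta)) * ln (m%:R / (alpha * delta)) |.
  move=> fP; exists (stateless f); split; first exact: stateless_robust.
  by rewrite space_stateless mulr_ge0// ltW.
have [m0|m_gt0] := posnP m.
  by apply: (trivial_case (fun=> 0)) => a u; rewrite m0.
have [n0|n_gt0] := posnP n.
  by apply: (trivial_case (fun=> 0)) => a [[i ii] x]; exfalso; move: (ii); rewrite n0.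
have [a1|a1] := leP 1 alpha.
  apply: (trivial_case (fun=> 0)) => a u _.
  by rewrite /approx sub0r normrN ler_peMl.
have b01 : 0 < alpha / 10 <= 1/10 by lra.
have [one|two] := leqP #|memory A| 1.
  apply: (trivial_case (fun u => g [:: u])) => a u am.
  by rewrite -[X in approx X]al; apply: (one_state_approx one b01 corr).
have b1' : 0 < alpha / 10 <= 1 by lra.
have [s [s0 ssz sgrid]] := value_grid n_gt0 hc b1'.
pose V := 'I_(size s); pose val (i : V) := nth 0 s i.
have grid a : (size a <= m)%N -> exists v : V, approx (alpha / 10) (g a) (val v).
  move=> /grange /sgrid[x xs ap].
  have ix : (index x s < size s)%N by rewrite index_mem.
  by exists (Ordinal ix); rewrite /val /= nth_index.
have [z0 z0P] : exists v : V, approx (alpha / 10) (g [::]) (val v) by apply: grid.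
have lam0 : (0 < lam)%N by apply: flip_number_gt0.
have delta01 : 0 < delta < 1 by lra.
have cV : #|V| = size s by rewrite card_ord.
pose S := Num.sqrt (ln (80 / delta) * lam.-1.+1%:R).
pose X := ln (2 * m%:R * (size s)%:R / delta).
pose q := (Num.truncn (800 * S * X)).+1.
have S1 : 1 <= S by apply: S_ge1.
have Xh : 1/2 <= X by apply: X_ge_half.
have SX : 0 <= S * X by rewrite mulr_ge0//; lra.
have qge : 800 * S * X <= q%:R by rewrite ltW// truncnS_gt.
have qle : q%:R <= 802 * (S * X).
  have half : 1/2 <= S * X by apply: le_trans Xh _; apply: SX_ge.
  apply: (@le_trans _ _ (800 * S * X + 1)); last lra.
  by rewrite /q -natr1 lerD2r truncn_le// -mulrA mulr_ge0.
have b1 := ratio_ge1 lam.-1 delta01.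
exists (robustify A q lam.-1 val z0 (alpha / 10) b1); split.
  rewrite -[X in robust_correct X]al; apply: robustify_correct => //.
  - by rewrite prednK.
  - by rewrite cV; apply: softmax_small_params.
  - rewrite cV; have [le|le] := leP (ln (80 / delta)) lam.-1.+1%:R.
      by left; apply: (many_flips_params delta01 m_gt0 s0 qge le).
    by right; apply: (few_flips_params delta01 m_gt0 s0 qge (ltW le)).
have A1 := space_bits_ge1 two.
rewrite space_robustify ?(ltnW two)//.
have q0 : 0 <= q%:R :> R by [].
have Xq : X <= q%:R.
  have : X <= S * X by apply: SX_ge.
  by move: qge Xh; clear; lra.
have small : (ln #|V|%:R + ln lam.-1.+1%:R) / ln 2 <= 2 * q%:R :> R.
  have ln2 := ln2_ge R.
  rewrite ler_pdivrMr; last lra.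
  apply: (@le_trans _ _ X); last first.
    move: (ler_wpM2l q0 ln2) Xq; clear; lra.
  rewrite -lnM ?posrE ?ltr0n ?cV// ler_ln ?posrE ?mulr_gt0 ?ltr0n//.
    have lm : lam.-1.+1%:R <= 2 * m%:R :> R.
      rewrite -natrM ler_nat prednK// (leq_trans (flip_number_le _ _ _))//.
      by rewrite mul2n -addnn -addn1 leq_add2l.
    apply: (@le_trans _ _ ((size s)%:R * (2 * m%:R))); first by rewrite ler_wpM2l.
    rewrite (_ : _ / delta = (size s)%:R * (2 * m%:R) * delta^-1); last by ring.
    by rewrite ler_peMr ?mulr_ge0// invf_ge1//; case/andP: delta01 => _ /ltW.
  by rewrite invr_gt0.
have LA : 0 <= L0 by move: A1 spA; clear; lra.
apply: (@le_trans _ _ (22 * (q%:R * L0))).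
  rewrite natrM.
  move: small (ler_wpM2l q0 spA) (ler_wpM2l q0 A1); clear; lra.
set T := Num.sqrt _; set W := ln (m%:R / _).
apply: (@le_trans _ _ (space_const c k1 delta0 * (L0 * T * W))); last first.
  by rewrite ler_wpM2l ?ler_norm// ltW.
rewrite /space_const -!mulrA ler_pM2l//.
apply: (@le_trans _ _ (802 * (S * X) * L0)); first by rewrite ler_wpM2r.
rewrite -!mulrA ler_pM2l//.
have ST : S <= Num.sqrt (sqrt_const delta0) * T.
  by rewrite /S /T prednK//; apply: sqrt_le.
have XW : X <= log_const c k1 delta0 * W.
  apply: (@log_le R c k1 delta0 hc hk1 d001 n m (size s) alpha delta
    m_gt0 s0 lnm _ dd ssz).
  by rewrite a0.
have SXW : S * X <= Num.sqrt (sqrt_const delta0) * T * (log_const c k1 delta0 * W).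
  by rewrite ler_pM//; lra.
by move: (ler_wpM2r LA SXW); clear; lra.
Qed.
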